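(* Let $\lambda/\mu$ be an edge-connected skew diagram with an outside decomposition $\Theta=(\theta_1,\dots,\theta_n)$, and let ${\bf k}\in T^{\mathrm{diag}}(\lambda/\mu)$. Then, as polynomials in $T$, \[ \zeta^*({\bf k})=\det\big(\zeta^*(R^{\bf k}_\Theta(i,j))\big)_{1\le i,j\le n}, \] where $\zeta^*(R^{\bf k}_\Theta(i,j))$ is set to $0$ if $R_\Theta(i,j)$ is undefined and $\zeta^*(\emptyset)=1$.
   Context: Skew diagrams $D(\lambda/\mu)=\{(i,j):1\le i\le h,\ \mu_i<j\le\lambda_i\}$ for partitions $\mu\subset\lambda$ (row index increasing downward); edge-connected means connected via shared edges. Young tableaux ${\bf k}=(k_{i,j})$ assign positive integers to boxes. $\mathrm{SSYT}_M$ = fillings with positive integers $<M$, weakly increasing along rows, strictly increasing down columns. Truncated Schur multiple zeta value: $\zeta_M({\bf k})=\sum_{(m_{i,j})\in\mathrm{SSYT}_M}\prod m_{i,j}^{-k_{i,j}}$. For each tableau ${\bf k}$ there is a unique polynomial $\zeta^*({\bf k})=\zeta^*({\bf k};T)\in\mathbb{R}[T]$ with $\zeta_M({\bf k})=\zeta^*({\bf k};\log M+\gamma)+O(\log^J(M)/M)$ as $M\to\infty$ ($\gamma$ Euler's constant, $J$ some integer); this is the regularized Schur multiple zeta value (it depends only on the shape up to translation). Content: $c(D)=\{j-i:(i,j)\in D\}$. A ribbon is an edge-connected skew diagram with no $2\times2$ square (it has one box of each content in an integer interval; starting box = minimal content, ending box = maximal content). An outside decomposition $\Theta=(\theta_1,\dots,\theta_n)$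 of $\lambda/\mu$ is a tuple of ribbons with disjoint union $D(\lambda/\mu)$, each starting box $(s,t)$ satisfying $(s,t-1)\notin D$ or $(s+1,t)\notin D$, each ending box $(u,v)$ satisfying $(u,v+1)\notin D$ or $(u-1,v)\notin D$. There is a ribbon $R_\Theta$, unique up to translation by $(t,t)$, with $c(R_\Theta)=c(\lambda/\mu)$ containing a diagonal translate of each $\theta_i$. $R_\Theta(i,j)$ is: the set of boxes of $R_\Theta$ with content in $[\min c(\theta_i),\max c(\theta_j)]$ if $\min c(\theta_i)\le\max c(\theta_j)$; $\emptyset$ if $\min c(\theta_i)=\max c(\theta_j)+1$; undefined otherwise. $T^{\mathrm{diag}}(\lambda/\mu)$: tableaux with $k_{i,j}=k_{i',j'}$ whenever $j-i=j'-i'$. $R^{\bf k}_\Theta(i,j)$ is the tableau of shape $R_\Theta(i,j)$ whose entry at a box of content $c$ equals the value of ${\bf k}$ on content $c$.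
   Formalization: R_Θ is not unique as described (a row of two boxes cut into two single boxes allows two ribbons, and the horizontal one fails); it is also required that adjacent boxes of λ/μ lying in a common diagonal translate of R_Θ belong to the same strip. *)

(* Defs.v *)
From mathcomp Require Import all_boot all_order all_algebra finmap.
From mathcomp Require Import all_classical all_reals all_analysis.

Set Implicit Arguments.
Unset Strict Implicit.
Unset Printing Implicit Defensive.

Import Order.TTheory GRing.Theory Num.Theory.
Import numFieldNormedType.Exports.

Local Open Scope classical_set_scope.
Local Open Scope fset_scope.
Local Open Scope ring_scope.

(* A box is (row, column), both counted from 1 in a Young diagram, with rows
   increasing downward. Coordinates are in int so that diagonal translations
   are total. *)
Definition box : Type := (int * int)%type.

Definition box_content (b : box) : int := b.2 - b.1.

Definition diag_shift (t : int) (b : box) : box := (b.1 + t, b.2 + t).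

Definition is_partition (s : seq nat) : bool := sorted geq s && (0%N \notin s).

(* Partitions are extended by zeros. *)
Definition subpartition (mu lam : seq nat) : Prop :=
  forall i, (nth 0%N mu i <= nth 0%N lam i)%N.

Definition skew_diagram (lam mu : seq nat) : {fset box} :=
  [fset ((i.+1)%:Z, (j.+1)%:Z) | i in iota 0 (size lam),
     j in iota (nth 0%N mu i) (nth 0%N lam i - nth 0%N mu i)].

Definition is_skew_diagram (D : {fset box}) : Prop :=
  exists lam mu : seq nat, [/\ is_partition lam, is_partition mu,
    subpartition mu lam & D = skew_diagram lam mu].

Definition edge_adjacent (a b : box) : bool := `|a.1 - b.1| + `|a.2 - b.2| == 1.

Definition edge_connected (D : {fset box}) : Prop :=
  forall x y : D, connect (fun a b : D => edge_adjacent (val a) (val b)) x y.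

Definition contents (D : {fset box}) : {fset int} := [fset box_content b | b in D].

(* Only meaningful for nonempty D. *)
Definition min_content (D : {fset box}) : int :=
  head 0 (sort <=%O (enum_fset (contents D))).
Definition max_content (D : {fset box}) : int :=
  last 0 (sort <=%O (enum_fset (contents D))).

Definition has_square (D : {fset box}) : Prop :=
  exists i j : int, [/\ (i, j) \in D, (i + 1, j) \in D,
    (i, j + 1) \in D & (i + 1, j + 1) \in D].

Definition ribbon (D : {fset box}) : Prop :=
  [/\ D != fset0, is_skew_diagram D, edge_connected D & ~ has_square D].

Definition outside_decomposition (D : {fset box}) (n : nat)
    (Theta : 'I_n -> {fset box}) : Prop :=
  [/\ forall i, ribbon (Theta i),
      forall i j, i != j -> [disjoint Theta i & Theta j]%fset,
      \big[fsetU/fset0]_(i < n) Theta i = D,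
      forall i s t, (s, t) \in Theta i ->
        box_content (s, t) = min_content (Theta i) ->
        (s, t - 1) \notin D \/ (s + 1, t) \notin D
    & forall i u v, (u, v) \in Theta i ->
        box_content (u, v) = max_content (Theta i) ->
        (u, v + 1) \notin D \/ (u - 1, v) \notin D].

(* S is the ribbon R_Theta of the outside decomposition Theta of D. The last
   condition (the strips are cut out of D by the diagonal translates of S) is
   what makes S unique up to translation: where no strip passes from content c
   to content c + 1, the preceding conditions leave the direction of that step
   of S open. E.g. for a row of two boxes cut into two single boxes both
   two-box ribbons contain translates of the strips, but R_Theta is the
   vertical one (the strips leave D upwards); with the horizontal one the
   determinant formula fails. *)
Definition is_cutting_strip (D : {fset box}) (n : nat)
    (Theta : 'I_n -> {fset box}) (S : {fset box}) : Prop :=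
  [/\ ribbon S,
      contents S = contents D,
      forall i, exists t : int, forall b, b \in Theta i -> diag_shift t b \in S
    & forall b b', b \in D -> b' \in D -> edge_adjacent b b' ->
        (exists t : int, diag_shift t b \in S /\ diag_shift t b' \in S) ->
        exists i, b \in Theta i /\ b' \in Theta i].

(* One of the ribbons R_Theta, which are diagonal translates of each other. *)
Definition cutting_strip (D : {fset box}) (n : nat)
    (Theta : 'I_n -> {fset box}) : {fset box} :=
  xget fset0 [set S | is_cutting_strip D Theta S].

(* A tableau of shape D is the restriction to D of a function k : box -> nat;
   values of k outside D are never used. *)
Definition is_tableau (D : {fset box}) (k : box -> nat) : Prop :=
  forall b, b \in D -> (0 < k b)%N.

Definition diagonal_tableau (D : {fset box}) (k : box -> nat) : Prop :=
  is_tableau D k /\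
  forall b b', b \in D -> b' \in D -> box_content b = box_content b' -> k b = k b'.

(* The value of a diagonal tableau on content c (0 if c is not a content). *)
Definition content_value (D : {fset box}) (k : box -> nat) (c : int) : nat :=
  if [pick b : D | box_content (val b) == c] is Some b then k (val b) else 0%N.

(* Entries range over 'I_M, i.e. are < M. *)
Definition is_ssyt (D : {fset box}) (M : nat) (m : {ffun D -> 'I_M}) : bool :=
  [&& [forall b, (0 < m b)%N],
      [forall b, forall b', ((val b).1 == (val b').1) &&
         ((val b).2 <= (val b').2) ==> (m b <= m b')%N]
    & [forall b, forall b', ((val b).2 == (val b').2) &&
         ((val b).1 < (val b').1) ==> (m b < m b')%N]].

Definition zeta_trunc (R : realType) (D : {fset box}) (k : box -> nat)
    (M : nat) : R :=
  \sum_(m : {ffun D -> 'I_M} | is_ssyt m)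
    \prod_(b : D) ((m b)%:R ^- k (val b)).

Definition euler_gamma (R : realType) : R :=
  lim ((fun n : nat => series harmonic n - ln n%:R : R) @ \oo).

Definition is_regularization (R : realType) (D : {fset box})
    (k : box -> nat) (P : {poly R}) : Prop :=
  exists J : nat,
    (fun M : nat => zeta_trunc R D k M - P.[ln M%:R + euler_gamma R] : R)
      =O_\oo (fun M : nat => ln M%:R ^+ J / M%:R : R).

(* The unique P with is_regularization D k P. *)
Definition zeta_star (R : realType) (D : {fset box}) (k : box -> nat) :
    {poly R} :=
  xget 0 [set P | is_regularization D k P].

(* zeta^* of the tableau R^k_Theta(i, j); 0 when R_Theta(i, j) is undefined. *)
Definition zeta_star_entry (R : realType) (D : {fset box}) (n : nat)
    (Theta : 'I_n -> {fset box}) (k : box -> nat) (i j : 'I_n) : {poly R} :=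
  let p := min_content (Theta i) in
  let q := max_content (Theta j) in
  if p <= q then
    zeta_star R [fset b in cutting_strip D Theta | p <= box_content b <= q]
      (fun b => content_value D k (box_content b))
  else if p == q + 1 then 1
  else 0.

(* Main.v *)
Require Import Defs.
From mathcomp Require Import all_boot all_order all_fingroup all_algebra finmap.
From mathcomp Require Import zify ring lra.
From mathcomp Require Import all_classical all_reals all_analysis.
From mathcomp Require Import polyrcf.

(* The truncated identity holds for every M: sweep the diagram diagonal by
   diagonal.  All strips cross from content c to content c + 1 in the direction
   of the cutting strip, so along a diagonal the rows of the matrix of path
   generating functions, read in the order of the diagram, are nested partial
   sums.  Subtracting from each row the next one leaves sums over exactly those
   entries of the next diagonal that interlace with the current one; expanding
   the determinant by multilinearity then adds one diagonal to the tableau, with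
   no signs and no path-crossing involution.  A ribbon is the case of a single
   strip.

   For the regularization, path sums along a ribbon are built by iterating
   s |-> sum_(0 < b < M) s(b) / b^k, which preserves the sequences of the form
   P(log M) + O(log^J M / M).  These form a ring in which P is unique and
   multiplicative, so the identity passes from truncated to regularized values;
   Euler's constant only translates the variable of the polynomials. *)

Set Implicit Arguments.
Unset Strict Implicit.
Unset Printing Implicit Defensive.

Import Order.TTheory GRing.Theory Num.Theory.
Import numFieldNormedType.Exports.

Local Open Scope classical_set_scope.
Local Open Scope fset_scope.
Local Open Scope ring_scope.

(** * Determinants *)

(** Strips begin and end at different contents, whereas the determinant has one fixed size. Rows are
    therefore indexed by strips during the whole sweep: before its first diagonal a strip holds its
    row of complete strip sums, after its last one a row of the identity. The delicate diagonals are
    those on which a strip ends. There the subtraction of rows leaves a Kronecker term in the row of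
    the ending strip, and convexity of the shape excludes that term from the rows that go on. On the
    analytic side, a ribbon mixes weak increases with strict decreases. An inner sum therefore
    depends both on the bound [M] and on the preceding entry, and the induction has to run over
    functions of two variables; finite sums of products of one-variable functions suffice. *)

Lemma det_unitriangular_rank (K : comNzRingType) (n : nat) (U : 'M[K]_n)
    (rk : 'I_n -> int) :
  (forall i, U i i = 1) -> (forall i j, i != j -> rk j <= rk i -> U i j = 0) ->
  \det U = 1.
Proof.
move=> U1 U0; rewrite /determinant (bigD1 (1%g : {perm 'I_n})) //= odd_perm1 expr0 mul1r.
rewrite big1 => [|i _]; last by rewrite perm1 U1.
rewrite big1 ?addr0 // => s s1.
(* The changes of rank along [s] sum to zero, so a non-identity [s] cannot raise the rank at every
   index that it moves. *)
suff [i /andP[si ri]] : exists i, (s i != i) && (rk (s i) <= rk i).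
  by rewrite (bigD1 i) //= U0 ?mul0r ?mulr0 // eq_sym.
apply/existsP; apply: contraNT s1 => /existsPn h.
have ge0 i : true -> 0 <= rk (s i) - rk i.
  move=> _; have := h i; case: eqP => [->|_] /=; first by rewrite subrr.
  by rewrite -ltNge subr_ge0 => /ltW.
have /eqP : \sum_i (rk (s i) - rk i) = 0.
  by rewrite big_split sumrN /= [X in _ - X](reindex_inj (@perm_inj _ s)) subrr.
rewrite psumr_eq0 // => /allP eq0; apply/eqP/permP => i; rewrite perm1.
have := h i; case: eqP => //= _; rewrite -ltNge.
have /eqP/subr0_eq -> := eq0 i (mem_index_enum i).
by rewrite ltxx.
Qed.

Lemma det_row_sum (K : comNzRingType) (n : nat) (B : finType)
    (w : 'I_n -> B -> K) (V : 'I_n -> B -> 'I_n -> K) :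
  \det (\matrix_(i, j) \sum_b w i b * V i b j) =
  \sum_(g : {ffun 'I_n -> B}) (\prod_i w i (g i)) *
    \det (\matrix_(i, j) V i (g i) j).
Proof.
rewrite /determinant; transitivity (\sum_(s : {perm 'I_n}) \sum_(g : {ffun 'I_n -> B})
    (\prod_i w i (g i)) * ((-1) ^+ s * \prod_i V i (g i) (s i))); last first.
  rewrite exchange_big; apply: eq_bigr => g _; rewrite mulr_sumr.
  by apply: eq_bigr => s _; do 2!congr (_ * _); apply: eq_bigr => i _; rewrite !mxE.
apply: eq_bigr => s _.
under eq_bigr do rewrite mxE.
rewrite bigA_distr_bigA big_distrr; apply: eq_bigr => g _ /=.
by rewrite big_split mulrCA.
Qed.

(** Expansion along column [i0] deletes row [i0], whose other entries are thus arbitrary. This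
    absorbs the row of a strip that ends. *)
Lemma det_unit_col (K : comNzRingType) (n : nat) (A B : 'M[K]_n) (i0 : 'I_n) :
  (forall i, A i i0 = (i == i0)%:R) -> (forall i, B i i0 = (i == i0)%:R) ->
  (forall i j, i != i0 -> A i j = B i j) -> \det A = \det B.
Proof.
move=> A0 B0 AB; rewrite (expand_det_col A i0) (expand_det_col B i0).
apply: eq_bigr => i _; rewrite A0 B0; case: eqP => [->|_]; last by rewrite !mul0r.
by congr (_ * (_ * \det _)); apply/matrixP => k l; rewrite !mxE AB // eq_sym neq_lift.
Qed.

(** * Truncated sums: sweeping the diagonals *)

Section PathSums.
Variables (K : comNzRingType) (M : nat) (x : int -> nat -> K) (rho : int -> int).

(** [rho c] is the row at content [c]. An equal row is a step to the right, where entries increase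
    weakly; otherwise the step goes up a column, where they drop. *)
Definition step_rel (c : int) (a b : nat) : bool :=
  if rho (c + 1) == rho c then (a <= b)%N else (b < a)%N.

(** The factor of the starting entry [a] is left out, because in the sweep [a] is already fixed by
    the tableau built so far. *)
Fixpoint path_sum (l : nat) (c : int) (a : nat) : K :=
  if l is l'.+1 then
    \sum_(b < M | (0 < b)%N && step_rel c a b) x (c + 1) b * path_sum l' (c + 1) b
  else 1.

Definition tail_sum (c q : int) (a : nat) : K :=
  if c <= q then path_sum (absz (q - c)) c a else 0.

Definition strip_sum (p q : int) : K :=
  if p <= q then \sum_(b < M | (0 < b)%N) x p b * tail_sum p q b
  else (p == q + 1)%:R.

(** With the convention 0 for [c > q], one recurrence covers all [c] and [q]; the Kronecker term is
    the end of the path. *)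
Lemma tail_sumE c q a :
  tail_sum c q a = (c == q)%:R +
    \sum_(b < M | (0 < b)%N && step_rel c a b) x (c + 1) b * tail_sum (c + 1) q b.
Proof.
rewrite /tail_sum; case: (ltgtP c q) => [cq|cq|->].
- rewrite add0r lezD1 cq; have -> : absz (q - c) = (absz (q - (c + 1))%R).+1 by lia.
  by [].
- by rewrite add0r big1 // => b _; rewrite ifF ?mulr0 //; lia.
- rewrite subrr big1 ?addr0 // => b _.
  by rewrite ifF ?mulr0 //; lia.
Qed.

(** The same shape as [tail_sumE] without a constraint from a preceding box, so a strip about to
    start is treated like one already running. Here the Kronecker term is the empty ribbon, of value
    1. *)
Lemma strip_sumE c q :
  strip_sum (c + 1) q = (c == q)%:R +
    \sum_(b < M | (0 < b)%N) x (c + 1) b * tail_sum (c + 1) q b.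
Proof.
rewrite /strip_sum; case: ifP => cq.
  by rewrite (_ : (c == q) = false) ?add0r //; lia.
rewrite big1 ?addr0 => [|b _]; first by congr ((nat_of_bool _)%:R); lia.
by rewrite /tail_sum cq mulr0.
Qed.

End PathSums.

Section StripSystem.
Variables (D : {fset box}) (n : nat) (rho : int -> int) (t p q : 'I_n -> int).

Definition alive (i : 'I_n) (c : int) : bool := p i <= c <= q i.

(* Also defined where strip [i] has no box: the extrapolation of the strip along
   [rho]. *)
Definition strip_box (i : 'I_n) (c : int) : box :=
  (rho c - t i, rho c - t i + c).

Definition convex : Prop := forall x y z : box, x \in D -> y \in D ->
  x.1 <= z.1 <= y.1 -> x.2 <= z.2 <= y.2 -> z \in D.

Hypothesis Dconvex : convex.
Hypothesis rho_step : forall c, rho (c + 1) = rho c \/ rho (c + 1) = rho c - 1.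
Hypothesis DP : forall b : box, reflect
  (exists i, alive i (box_content b) /\ b.1 = rho (box_content b) - t i) (b \in D).
(** For one strip alive at [c] and another at [c + 1], this forbids that a strip resumes in line
    with one that has just ended: the last condition on a cutting strip. *)
Hypothesis strip_inj : forall i j c, alive i c || alive i (c + 1) ->
  alive j c || alive j (c + 1) -> t i = t j -> i = j.

Lemma strip_boxP c r : reflect
  (exists2 i, alive i c & r = rho c - t i) ((r, r + c) \in D).
Proof.
apply: (iffP (DP _)) => [[i]|[i]]; rewrite /box_content /= (addrC r) addrK.
  by case=> ??; exists i.
by move=> ??; exists i.
Qed.

Lemma convex_diag c1 c2 c r1 r2 r : (r1, r1 + c1) \in D -> (r2, r2 + c2) \in D ->
  r1 <= r <= r2 -> r1 + c1 <= r + c <= r2 + c2 -> (r, r + c) \in D.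
Proof. by move=> *; apply: (Dconvex (x := (r1, r1 + c1)) (y := (r2, r2 + c2))). Qed.

(** By [strip_inj], a strip extended one step past either end leaves the diagram, so membership in
    [D] detects whether it is alive. *)
Lemma strip_box_in i c c' : (c' == c) || (c' == c + 1) ->
  alive i c || alive i (c + 1) -> (strip_box i c' \in D) = alive i c'.
Proof.
move=> cc' ai; apply/strip_boxP/idP => [[j aj rij]|]; last by exists i.
suff -> : i = j by [].
apply: (@strip_inj i j c) => //; last by lia.
by case/orP: cc' => /eqP <-; rewrite aj ?orbT.
Qed.

Definition diag_dir (c : int) : int := if rho (c + 1) == rho c then 1 else -1.

(* Of the left and lower neighbours of [strip_box i (c + 1)], both of content
   [c], the one other than [strip_box i c]. *)
Definition side_box (i : 'I_n) (c : int) : box :=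
  (rho c - t i + diag_dir c, rho c - t i + diag_dir c + c).

(** The next box of the strip lies between its current box and the side box in the product order, so
    convexity does not let the strip end. *)
Lemma side_box_alive i c : alive i c || alive i (c + 1) ->
  side_box i c \in D -> alive i (c + 1).
Proof.
move=> ai sD; case/orP: (ai) => // aic.
rewrite -(strip_box_in (c := c)) ?eqxx ?orbT //.
have bD : strip_box i c \in D by rewrite (strip_box_in (c := c)) ?eqxx.
move: sD bD; rewrite /side_box /strip_box /diag_dir.
case: eqP => [->|ne] sD bD; first by apply: (convex_diag bD sD); lia.
by case: (rho_step c) => // ->; apply: (convex_diag sD bD); lia.
Qed.

(** The ending strip [j] lies strictly beyond strip [i] in the direction [diag_dir c], since
    otherwise convexity would contain its next box. The side box of [i] is then enclosed between the
    two strips. *)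
Lemma side_box_death i j c : alive i (c + 1) -> p j <= q j -> q j = c ->
  side_box i c \in D.
Proof.
move=> ai pq qj.
have aj : alive j c by rewrite /alive; lia.
have iD : strip_box i (c + 1) \in D by rewrite (strip_box_in (c := c)) ?eqxx ?ai ?orbT.
have jD : strip_box j c \in D by rewrite (strip_box_in (c := c)) ?eqxx ?aj.
have : strip_box j (c + 1) \notin D.
  by rewrite (strip_box_in (c := c)) ?eqxx ?orbT ?aj // /alive; lia.
move: iD jD; rewrite /side_box /strip_box /diag_dir.
case: eqP => [->|ne] iD jD.
  case: (lerP (rho c - t j) (rho c - t i)) => ij njD.
    by case/negP: njD; apply: (convex_diag jD iD); lia.
  by apply: (convex_diag iD jD); lia.
case: (rho_step c) => // E; move: iD; rewrite E => iD.
case: (lerP (rho c - t i) (rho c - t j)) => ij njD.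
  by case/negP: njD; apply: (convex_diag iD jD); lia.
by apply: (convex_diag jD iD); lia.
Qed.

(** Two ends on one diagonal would enclose the next box of one of them. *)
Lemma death_unique i j c : p i <= q i -> p j <= q j -> q i = c -> q j = c -> i = j.
Proof.
move=> pi pj qi qj.
have ai : alive i c by rewrite /alive; lia.
have aj : alive j c by rewrite /alive; lia.
wlog ij : i j pi pj qi qj ai aj / rho c - t i <= rho c - t j.
  move=> W; case: (lerP (rho c - t i) (rho c - t j)) => [|/ltW] /W; first exact.
  by move/(_ pj pi qj qi aj ai).
case: (eqVneq (t i) (t j)) => [tij|tij].
  by apply: (@strip_inj i j c); rewrite ?ai ?aj.
have iD : strip_box i c \in D by rewrite (strip_box_in (c := c)) ?eqxx ?ai.
have jD : strip_box j c \in D by rewrite (strip_box_in (c := c)) ?eqxx ?aj.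
have /negP niD : strip_box i (c + 1) \notin D.
  by rewrite (strip_box_in (c := c)) ?eqxx ?orbT ?ai // /alive; lia.
have /negP njD : strip_box j (c + 1) \notin D.
  by rewrite (strip_box_in (c := c)) ?eqxx ?orbT ?aj // /alive; lia.
move: iD jD niD njD; rewrite /strip_box.
by case: (rho_step c) => -> iD jD niD njD; [case: niD|case: njD];
  apply: (convex_diag iD jD); lia.
Qed.

Hypothesis p_le_q : forall i, p i <= q i.
Variables (K : comNzRingType) (M : nat) (x : int -> nat -> K).

(* Interpolates between the matrix of strip sums ([c] below all contents) and
   the identity ([c] above all contents). *)
Definition state_mx (c : int) (a : 'I_n -> nat) : 'M[K]_n :=
  \matrix_(i, j)
    if c < p i then strip_sum M.+1 x rho (p i) (q j)
    else if c <= q i then tail_sum M.+1 x rho c (q j) (a i)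
    else (i == j)%:R.

(** The conditions towards the left and the lower neighbour are negations of each other as
    relations: whichever one [step_rel] expresses along the strip, its negation is the one required
    at the side box. *)
Definition step_ok (c : int) (m : box -> nat) (i : 'I_n) (b : nat) : bool :=
  [&& (0 < b)%N,
      (strip_box i c \in D) ==> step_rel rho c (m (strip_box i c)) b
    & (side_box i c \in D) ==> ~~ step_rel rho c (m (side_box i c)) b].

(** The value 0, forbidden for genuine entries, is the dummy label of a strip with no box at content
    [c + 1]; so the choice functions always have domain ['I_n]. *)
Definition step_weight (c : int) (m : box -> nat) (i : 'I_n) (b : 'I_M.+1) : K :=
  if alive i (c + 1) then (step_ok c m i b)%:R * x (c + 1) b else (b == ord0)%:R.

Lemma state_mx_step (c : int) (m : box -> nat) :
  (forall r, (r, r + c) \in D -> (r + 1, r + 1 + c) \in D ->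
     (m (r, r + c)%R <= m (r + 1, r + 1 + c)%R)%N) ->
  \det (state_mx c (fun i => m (strip_box i c))) =
  \sum_(g : {ffun 'I_n -> 'I_M.+1}) (\prod_i step_weight c m i (g i)) *
     \det (state_mx (c + 1) (fun i => g i)).
Proof.
move=> m_diag; set H := state_mx c _.
pose act i := alive i c || alive i (c + 1).
(* [N i k] says that strip [k] passes through the side box of the active strip [i]; at most one [k]
   does. *)
pose N i k := [&& act i, alive k c & t k == t i - diag_dir c].
pose U : 'M[K]_n := \matrix_(i, k) ((i == k)%:R - (N i k)%:R).
have dd : diag_dir c = 1 \/ diag_dir c = -1.
  by rewrite /diag_dir; case: ifP => _; [left|right].
have NP i k : N i k -> side_box i c = strip_box k c.
  case/and3P=> _ _ /eqP tk; rewrite /side_box /strip_box tk.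
  by congr (_, _); lia.
have N_ex i : act i -> side_box i c \in D ->
    exists2 k, side_box i c = strip_box k c & forall k', N i k' = (k' == k).
  move=> ai /strip_boxP [k ak tk]; have Nk : N i k by rewrite /N ai ak; lia.
  exists k => [|k']; first exact: NP.
  apply/idP/eqP => [|-> //]; case/and3P=> _ ak' /eqP tk'.
  by apply: (@strip_inj k' k c); rewrite ?ak ?ak' //; lia.
have N0 i k : side_box i c \notin D -> N i k = false.
  apply: contraNF => Nik; rewrite (NP _ _ Nik).
  by case/and3P: (Nik) => _ ak _; rewrite (strip_box_in (c := c)) ?eqxx ?ak.
(* [U *m H] subtracts from the row of strip [i] the row of the strip through
   [side_box i c]; the two rows are nested sums. *)
have detU : \det U = 1.
  (* [N i k] gives [t k = t i - diag_dir c], so this rank grows by exactly one from [i] to [k]. *)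
  apply: (@det_unitriangular_rank _ _ _ (fun i => - diag_dir c * t i)).
    move=> i; rewrite mxE eqxx (_ : N i i = false) ?subr0 //.
    by apply/negP => /and3P[_ _]; lia.
  move=> i j ij rij; rewrite mxE (negPf ij) (_ : N i j = false) ?subr0 //.
  by apply/negP => /and3P[_ _]; case: dd rij => ->; lia.
have UE i j : (U *m H) i j = H i j - \sum_(k | N i k) H k j.
  rewrite mxE; under eq_bigr do rewrite mxE mulrBl.
  rewrite big_split sumrN /=; congr (_ - _).
    rewrite (bigD1 i) //= eqxx mul1r big1 ?addr0 // => k ki.
    by rewrite eq_sym (negPf ki) mul0r.
  rewrite [RHS]big_mkcond; apply: eq_bigr => k _.
  by case: ifP; rewrite ?mul1r ?mul0r.
have Hact i j : act i -> H i j = (c == q j)%:R +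
    \sum_(b < M.+1 | (0 < b)%N &&
        ((strip_box i c \in D) ==> step_rel rho c (m (strip_box i c)) b))
      x (c + 1) b * tail_sum M.+1 x rho (c + 1) (q j) b.
  move=> ai; rewrite (strip_box_in (c := c)) ?eqxx // mxE.
  case aic: (alive i c).
    rewrite ifF; last by move: aic; rewrite /alive; lia.
    by rewrite ifT ?tail_sumE //; move: aic; rewrite /alive; lia.
  have pi : p i = c + 1 by move: ai aic; rewrite /act /alive; lia.
  rewrite ifT; last by lia.
  by rewrite pi strip_sumE; congr (_ + _); apply: eq_bigl => b; rewrite andbT.
(* If the side box is in [D], the Kronecker terms of the two rows cancel. Since [m] increases down
   the diagonal, the range of the subtracted sum is contained in that of strip [i], and the
   difference is the sum over its complement. *)
have key i j : act i -> (U *m H) i j = ((c == q j) && (side_box i c \notin D))%:R +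
    \sum_(b < M.+1 | step_ok c m i b)
      x (c + 1) b * tail_sum M.+1 x rho (c + 1) (q j) b.
  move=> ai; rewrite UE Hact //; case: (boolP (side_box i c \in D)) => sD; last first.
    rewrite [X in _ - X]big_pred0 => [|k]; last exact: N0.
    by rewrite subr0 andbT; congr (_ + _); apply: eq_bigl => b; rewrite /step_ok (negPf sD) andbT.
  have [k sk Nk] := N_ex _ ai sD.
  have ak : alive k c by have := Nk k; rewrite eqxx => /and3P[].
  rewrite (big_pred1 k) // Hact /act ?ak // andbF add0r opprD addrACA subrr add0r -sk sD /=.
  rewrite (bigID (fun b : 'I__ => step_rel rho c (m (side_box i c)) b)) /=.
  rewrite [X in X + _ - _](_ : _ = \sum_(b < M.+1 | (0 < b)%N && step_rel rho c (m (side_box i c)) b)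
      x (c + 1) b * tail_sum M.+1 x rho (c + 1) (q j) b); last first.
    apply: eq_bigl => b; case: (boolP (step_rel rho c (m (side_box i c)) b)) => /= [r1|]; rewrite ?andbT ?andbF //.
    case: (boolP (strip_box i c \in D)) => /= iD; rewrite ?andbT //.
    case: (0 < b)%N => //=; move: r1 sD iD; rewrite /step_rel /side_box /strip_box /diag_dir.
    case: (rho (c + 1) == rho c) => r1 sD iD.
      by apply: leq_trans r1; apply: m_diag.
    apply: leq_trans r1 _; have := m_diag (rho c - t i - 1).
    by rewrite subrK; apply.
  rewrite addrAC subrr add0r; apply: eq_bigl => b.
  by rewrite /step_ok sD /= -!andbA.
pose V i (b : 'I_M.+1) j : K :=
  if c + 1 < p i then strip_sum M.+1 x rho (p i) (q j)
  else if c + 1 <= q i then tail_sum M.+1 x rho (c + 1) (q j) b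
  else (i == j)%:R.
pose W : 'M[K]_n := \matrix_(i, j) \sum_b step_weight c m i b * V i b j.
have -> : \det H = \det (U *m H) by rewrite det_mulmx detU mul1r.
transitivity (\det W); last first.
  exact: det_row_sum.
have Walive i j : alive i (c + 1) -> W i j =
    \sum_(b < M.+1 | step_ok c m i b) x (c + 1) b * tail_sum M.+1 x rho (c + 1) (q j) b.
  move=> ai; rewrite mxE [RHS]big_mkcond; apply: eq_bigr => b _.
  rewrite /step_weight ai /V ifF; last by move: ai; rewrite /alive; lia.
  rewrite ifT; last by move: ai; rewrite /alive; lia.
  by case: ifP; rewrite ?mul1r ?mul0r.
have Wdead i j : alive i (c + 1) = false -> W i j = V i ord0 j.
  move=> ai; rewrite mxE (bigD1 ord0) //= /step_weight ai eqxx mul1r.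
  by rewrite big1 ?addr0 // => b /negPf ->; rewrite mul0r.
have UW i j : q i != c -> (U *m H) i j = W i j.
  move=> qi; case ai: (alive i (c + 1)).
    rewrite Walive // key ?/act ?ai ?orbT //.
    rewrite (_ : _ && _ = false) ?add0r //; apply/negP => /andP[/eqP qj /negP[]].
    exact: (@side_box_death i j).
  have nai : act i = false by move: ai qi; rewrite /act /alive; lia.
  rewrite Wdead // UE big_pred0 => [|k]; last by rewrite /N nai.
  rewrite subr0 /V mxE; move: (p_le_q i) nai; rewrite /act /alive => pq nai.
  have -> : (c < p i) = (c + 1 < p i) by lia.
  case: ifP => // ?; do 2!(rewrite ifF; last by lia); done.
have Wcol i j : q j = c -> W i j = (i == j)%:R.
  move=> qj; case ai: (alive i (c + 1)).
    rewrite Walive // big1 => [|b _].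
      by case: eqP => // ij; move: ai; rewrite /alive ij; lia.
    by rewrite /tail_sum ifF ?mulr0 //; lia.
  rewrite Wdead // /V; move: ai (p_le_q i); rewrite /alive => ai pq.
  case: ifP => [?|?]; last by rewrite ifF //; lia.
  rewrite /strip_sum ifF; last by lia.
  by case: (eqVneq i j) => [ij|_]; congr ((nat_of_bool _)%:R); first (subst; lia); lia.
(* If a strip ends at content [c], its column is a unit vector, so the other
   entries of its row do not matter. *)
case: (pickP (fun i => q i == c)) => [i0 /eqP qi0|qc]; last first.
  by rewrite (_ : U *m H = W) //; apply/matrixP => i j; rewrite UW // qc.
have Ui0 i : i != i0 -> q i != c.
  by apply: contraNneq => qi; apply/eqP; apply: (@death_unique i i0 c).
apply: (@det_unit_col _ _ _ _ i0) => [i|i|i j ii0]; [| exact: Wcol | by rewrite UW ?Ui0].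
case: (eqVneq i i0) => [->|ii0]; last by rewrite UW ?Ui0 // Wcol // (negPf ii0).
(* The ending strip keeps its Kronecker term: with its side box in [D] it would go on by
   [side_box_alive]. *)
have act0 : act i0 by rewrite /act /alive; have := p_le_q i0; lia.
rewrite key // qi0 eqxx big1 ?addr0 => [|b _].
  rewrite (_ : side_box i0 c \notin D) //; apply/negP => sD.
  by have := side_box_alive act0 sD; rewrite /alive; lia.
by rewrite /tail_sum ifF ?mulr0 //; lia.
Qed.

(** * Tableaux filled up to a given content *)

Definition left_box (b : box) : box := (b.1, b.2 - 1).
Definition below_box (b : box) : box := (b.1 + 1, b.2).

Definition tab_ok (f : box -> nat) (b : box) : bool :=
  [&& (0 < f b)%N, (left_box b \in D) ==> (f (left_box b) <= f b)%N
    & (below_box b \in D) ==> (f b < f (below_box b))%N].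

Definition tab_val (m : {ffun D -> 'I_M.+1}) (b : box) : 'I_M.+1 :=
  if insub b is Some b' then m b' else ord0.

Lemma tab_val_in m (b : D) : tab_val m (val b) = m b.
Proof. by rewrite /tab_val valK. Qed.

Lemma tab_val_out m b : b \notin D -> tab_val m b = ord0.
Proof. by move=> bD; rewrite /tab_val insubN. Qed.

Lemma step_okE c f i : alive i (c + 1) ->
  step_ok c f i (f (strip_box i (c + 1))) = tab_ok f (strip_box i (c + 1)).
Proof.
move=> ai; rewrite /step_ok /tab_ok; congr (_ && _).
have [E|E] : rho (c + 1) == rho c /\ rho (c + 1) = rho c \/
    (rho (c + 1) == rho c) = false /\ rho (c + 1) = rho c - 1.
- by case: (rho_step c) => E; [left|right]; split; rewrite ?E //; lia.
- have -> : left_box (strip_box i (c + 1)) = strip_box i c.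
    by rewrite /left_box /strip_box /= E.2; congr (_, _); lia.
  have -> : below_box (strip_box i (c + 1)) = side_box i c.
    by rewrite /below_box /strip_box /side_box /diag_dir /= E.1 E.2; congr (_, _); lia.
  by rewrite /step_rel E.1 -ltnNge.
- have -> : left_box (strip_box i (c + 1)) = side_box i c.
    by rewrite /left_box /strip_box /side_box /diag_dir /= E.1 E.2; congr (_, _); lia.
  have -> : below_box (strip_box i (c + 1)) = strip_box i c.
    by rewrite /below_box /strip_box /= E.2; congr (_, _); lia.
  by rewrite /step_rel E.1 -leqNgt andbC.
Qed.

Lemma step_ok_eq c f f' i b : (forall b, box_content b = c -> f b = f' b) ->
  step_ok c f i b = step_ok c f' i b.
Proof.
move=> ff'; rewrite /step_ok !ff' //; rewrite /box_content /=; lia.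
Qed.

(** Boxes beyond content [c] carry the dummy value 0, so the partial fillings for all [c] live in
    one finite type. *)
Definition partial_tab (c : int) (m : {ffun D -> 'I_M.+1}) : bool :=
  [forall b : D, if box_content (val b) <= c then tab_ok (tab_val m) (val b)
                 else m b == ord0].

Definition partial_weight (c : int) (m : {ffun D -> 'I_M.+1}) : K :=
  \prod_(b : D | box_content (val b) <= c) x (box_content (val b)) (m b).

(** The invariant of the sweep: the determinant of strip sums for small [c], the sum over all
    tableaux for large [c]. *)
Definition partial_sum (c : int) : K :=
  \sum_(m | partial_tab c m) partial_weight c m *
    \det (state_mx c (fun i => tab_val m (strip_box i c))).

(** By convexity the box below the first and left of the second is in [D]; both comparisons with it
    are conditions at boxes of content [c]. *)
Lemma partial_tab_diag c m r : partial_tab c m ->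
  (r, r + c) \in D -> (r + 1, r + 1 + c) \in D ->
  (tab_val m (r, r + c)%R <= tab_val m (r + 1, r + 1 + c)%R)%N.
Proof.
move=> /forallP mc b1 b2.
have bD : (r + 1, r + c) \in D by apply: (Dconvex b1 b2) => /=; lia.
have /= := mc [` b1]; rewrite ifT /box_content /=; last by lia.
case/and3P=> _ _; rewrite /below_box /= bD /= => lt1.
have /= := mc [` b2]; rewrite ifT /box_content /=; last by lia.
case/and3P=> _; rewrite /left_box /= (_ : r + 1 + c - 1 = r + c); last by lia.
by rewrite bD /= => le2 _; apply: leq_trans le2; apply: ltnW.
Qed.

Definition strip_of (b : box) : option 'I_n :=
  [pick i | alive i (box_content b) && (b.1 == rho (box_content b) - t i)].

Lemma strip_box_content i c : box_content (strip_box i c) = c.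
Proof. by rewrite /box_content /strip_box /=; lia. Qed.

Lemma strip_box_D i c : alive i c -> strip_box i c \in D.
Proof. by move=> ai; rewrite (strip_box_in (c := c)) ?eqxx ?ai. Qed.

Lemma strip_box_inj i j c : alive i c -> alive j c ->
  strip_box i c = strip_box j c -> i = j.
Proof.
move=> ai aj [E _]; apply: (@strip_inj i j c); rewrite ?ai ?aj //; lia.
Qed.

Lemma strip_of_box i c : alive i c -> strip_of (strip_box i c) = Some i.
Proof.
move=> ai; rewrite /strip_of strip_box_content; case: pickP => [j|/(_ i)].
  case/andP => aj /eqP /= E; congr Some; apply: (@strip_inj j i c); rewrite ?ai ?aj //; lia.
by rewrite ai eqxx.
Qed.

Lemma box_strip b : b \in D ->
  exists2 i, alive i (box_content b) & b = strip_box i (box_content b).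
Proof.
case/DP=> i [ai bi]; exists i => //; rewrite /strip_box -bi.
by case: b bi {ai} => b1 b2 /= _; rewrite /box_content /=; congr (_, _); lia.
Qed.

Lemma diagonal_prod (c : int) (F : box -> K) :
  \prod_(b : D | box_content (val b) == c) F (val b) =
  \prod_(i | alive i c) F (strip_box i c).
Proof.
transitivity (\prod_(b : D | box_content (val b) == c)
    \prod_(i | alive i c && (strip_box i c == val b)) F (strip_box i c)).
  apply: eq_bigr => b /eqP bc; have [i] := box_strip (valP b).
  rewrite bc => ai bi; rewrite (big_pred1 i) -?bi // => j.
  apply/andP/eqP => [[aj /eqP E]|->]; last by rewrite -bi ai.
  by apply: (strip_box_inj aj ai); rewrite E.
rewrite (exchange_big_dep (fun i => alive i c)) /=; last by move=> b i _ /andP[].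
apply: eq_bigr => i ai; rewrite (big_pred1 [` strip_box_D ai]) // => b.
rewrite ai; apply/andP/eqP => [[_ /eqP E]|->]; first exact: val_inj.
by rewrite /= strip_box_content !eqxx.
Qed.

Lemma state_mx_eq c a a' : (forall i, alive i c -> a i = a' i) ->
  state_mx c a = state_mx c a'.
Proof.
move=> aa'; apply/matrixP => i j; rewrite !mxE; case: ifP => // pc; case: ifP => // cq.
by rewrite aa' // /alive cq andbT; lia.
Qed.

Lemma partial_sum_step c : partial_sum c = partial_sum (c + 1).
Proof.
have le1 (z : int) : (z <= c + 1) = (z == c + 1) || (z <= c) by lia.
have ne1 (z : int) : z <= c -> (z == c + 1) = false by lia.
pose gok m (g : {ffun 'I_n -> 'I_M.+1}) := [forall i,
  if alive i (c + 1) then step_ok c (tab_val m) i (g i) else g i == ord0].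
transitivity (\sum_(m | partial_tab c m) \sum_(g | gok m g) partial_weight c m *
    ((\prod_(i | alive i (c + 1)) x (c + 1) (g i)) *
     \det (state_mx (c + 1) (fun i => g i)))).
  apply: eq_bigr => m mc; rewrite (state_mx_step (m := fun b => tab_val m b)); last first.
    by move=> r; apply: partial_tab_diag.
  rewrite mulr_sumr [RHS]big_mkcond; apply: eq_bigr => g _.
  case: ifP => [/forallP gm|/negbT/forallPn[i gi]].
    do 2!congr (_ * _); rewrite [RHS]big_mkcond; apply: eq_bigr => i _.
    rewrite /step_weight; have := gm i; case: ifP => _ => [->|/eqP -> //].
    by rewrite mul1r.
  rewrite (bigD1 i) //= /step_weight.
  by move: gi; case: ifP => _ /negPf ->; rewrite ?mul0r ?mulr0.
(* [hm] and [hg] split a filling up to content [c + 1] into its part up to [c] and its last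
   diagonal, read off strip by strip; [hi] glues them back. *)
pose hm (m : {ffun D -> 'I_M.+1}) : {ffun D -> 'I_M.+1} :=
  [ffun b => if box_content (val b) == c + 1 then ord0 else m b].
pose hg (m : {ffun D -> 'I_M.+1}) : {ffun 'I_n -> 'I_M.+1} :=
  [ffun i => if alive i (c + 1) then tab_val m (strip_box i (c + 1)) else ord0].
pose hi (mg : {ffun D -> 'I_M.+1} * {ffun 'I_n -> 'I_M.+1}) : {ffun D -> 'I_M.+1} :=
  [ffun b => if box_content (val b) == c + 1
             then (if strip_of (val b) is Some i then mg.2 i else ord0)
             else mg.1 b].
have hmE m b : tab_val (hm m) b =
    if box_content b == c + 1 then ord0 else tab_val m b.
  case: (boolP (b \in D)) => bD; last by rewrite !tab_val_out // if_same.
  by rewrite -[b]/(val [` bD]) !tab_val_in ffunE.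
rewrite pair_big_dep /= (reindex_onto (fun m => (hm m, hg m)) hi) /=; last first.
  case=> m g /andP[/= /forallP mc /forallP gm]; congr (_, _); apply/ffunP => i.
    rewrite !ffunE; case: eqP => // ic; have := mc i.
    by rewrite ic ifF => [/eqP ->|]; last by lia.
  rewrite !ffunE; case: ifP => ai; last by have := gm i; rewrite ai => /eqP.
  by rewrite -[strip_box _ _]/(val [` strip_box_D ai]) tab_val_in ffunE /=
    strip_box_content eqxx strip_of_box.
apply: eq_big => [m|m _].
  have -> /= : hi (hm m, hg m) == m.
    apply/eqP/ffunP => b; rewrite !ffunE /=; case: eqP => // bc.
    have [i ai bi] := box_strip (valP b); rewrite bc in ai bi.
    by rewrite [X in strip_of X]bi strip_of_box // ffunE ai -bi tab_val_in.
  (* [tab_ok] compares a box only with neighbours of content one less, so erasing diagonal [c + 1]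
     does not affect it at contents up to [c]. *)
  rewrite andbT; have okE b : box_content b <= c ->
      tab_ok (tab_val (hm m)) b = tab_ok (tab_val m) b.
    move=> bc; rewrite /tab_ok !hmE !ifF //; move: bc; rewrite /box_content /=; lia.
  have gE i : alive i (c + 1) -> step_ok c (tab_val (hm m)) i (hg m i) =
      tab_ok (tab_val m) (strip_box i (c + 1)).
    move=> ai; rewrite -step_okE // ffunE ai; apply: step_ok_eq => b bc.
    by rewrite hmE ifF //; lia.
  apply/andP/forallP => [[/forallP mc /forallP gm] b|mc].
    have := mc b; rewrite le1 ffunE.
    case: (eqVneq (box_content (val b)) (c + 1)) => /= [bc1 _|_].
      have [i ai bi] := box_strip (valP b); rewrite bc1 in ai bi.
      by have := gm i; rewrite ai gE // -bi.
    by case: ifP => // bc; rewrite okE.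
  split; apply/forallP => b.
    have := mc b; rewrite le1 ffunE; case: (leP (box_content (val b)) c) => bc.
      by rewrite orbT okE.
    by case: (eqVneq (box_content (val b)) (c + 1)).
  case: ifP => ab; last by rewrite ffunE ab.
  have := mc [` strip_box_D ab]; rewrite /= strip_box_content lexx.
  by rewrite gE.
rewrite (@state_mx_eq (c + 1) _ (fun i => tab_val m (strip_box i (c + 1)))); last first.
  by move=> i ai; rewrite ffunE ai.
rewrite mulrA; congr (_ * _).
rewrite /partial_weight [RHS](bigID (fun b : D => box_content (val b) == c + 1)) /= mulrC.
congr (_ * _).
  rewrite (eq_bigl (fun b : D => box_content (val b) == c + 1)); last first.
    by move=> b; rewrite /= le1; case: eqP => [->|] /=; rewrite ?andbF.
  rewrite (eq_bigr (fun b : D => x (box_content (val b)) (tab_val m (val b)))); last first.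
    by move=> b _; rewrite tab_val_in.
  rewrite (diagonal_prod (c + 1) (fun b => x (box_content b) (tab_val m b))).
  by apply: eq_bigr => i ai; rewrite ffunE ai strip_box_content.
apply: eq_big => [b|b bc]; last by rewrite ffunE ne1.
rewrite le1; case: (leP (box_content (val b)) c) => [/ne1 -> //|_].
by rewrite orbF andbN.
Qed.

Lemma p_content i : exists2 b, b \in D & box_content b = p i.
Proof.
exists (strip_box i (p i)); last exact: strip_box_content.
by apply: strip_box_D; rewrite /alive lexx p_le_q.
Qed.

Lemma q_content i : exists2 b, b \in D & box_content b = q i.
Proof.
exists (strip_box i (q i)); last exact: strip_box_content.
by apply: strip_box_D; rewrite /alive lexx p_le_q.
Qed.

Lemma partial_sum_low (c : int) : (forall b, b \in D -> c < box_content b) ->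
  partial_sum c = \det (\matrix_(i, j) strip_sum M.+1 x rho (p i) (q j)).
Proof.
move=> cD; rewrite /partial_sum (big_pred1 [ffun=> ord0]) => [|m].
  rewrite /partial_weight big_pred0 ?mul1r => [|b]; last first.
    by rewrite leNgt cD ?(valP b).
  rewrite (_ : state_mx _ _ = \matrix_(i, j) strip_sum M.+1 x rho (p i) (q j)) //.
  apply/matrixP => i j; rewrite !mxE ifT //.
  by have [b /cD] := p_content i => + <-.
apply/forallP/eqP => [h|-> b]; last by rewrite leNgt cD ?(valP b) // ffunE.
apply/ffunP => b; rewrite ffunE; have := h b.
by rewrite leNgt cD ?(valP b) //= => /eqP.
Qed.

Lemma partial_sum_high (c : int) : (forall b, b \in D -> box_content b < c) ->
  partial_sum c = \sum_(m : {ffun D -> 'I_M.+1} | [forall b : D, tab_ok (tab_val m) (val b)])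
     \prod_(b : D) x (box_content (val b)) (m b).
Proof.
move=> cD; apply: eq_big => m.
  apply: eq_forallb => b.
  by rewrite ifT //; apply/ltW/cD/valP.
move=> _; rewrite (_ : state_mx _ _ = 1%:M) ?det1 ?mulr1.
  by apply: eq_bigl => b; apply/ltW/cD/valP.
apply/matrixP => i j; rewrite !mxE.
have [b /cD bc bq] := q_content i; rewrite bq in bc.
by have pq := p_le_q i; rewrite !ifF //; lia.
Qed.

Lemma tableau_sum_det :
  \sum_(m : {ffun D -> 'I_M.+1} | [forall b : D, tab_ok (tab_val m) (val b)])
     \prod_(b : D) x (box_content (val b)) (m b) =
  \det (\matrix_(i, j) strip_sum M.+1 x rho (p i) (q j)).
Proof.
pose N : nat := (\sum_(b : D) absz (box_content (val b))).+1.
have bN (b : box) : b \in D -> (absz (box_content b) < N)%N.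
  by move=> bD; rewrite ltnS (bigD1 [` bD]) //= leq_addr.
have psk c k : partial_sum c = partial_sum (c + k%:Z).
  elim: k => [|k IH]; first by rewrite addr0.
  by rewrite IH partial_sum_step; congr partial_sum; lia.
rewrite -(partial_sum_high (c := N%:Z)) => [|b /bN]; last by lia.
rewrite -(partial_sum_low (c := - N%:Z)) => [|b /bN]; last by lia.
by rewrite (psk (- N%:Z) (N + N)%N); congr partial_sum; lia.
Qed.

(** Rows and columns of a convex shape have no gaps, so comparisons of neighbours chain. *)
Lemma is_ssytE (m : {ffun D -> 'I_M.+1}) :
  is_ssyt m = [forall b : D, tab_ok (tab_val m) (val b)].
Proof.
apply/and3P/forallP => [[/forallP pos /forallP row /forallP col] b|ok].
  rewrite /tab_ok tab_val_in pos /=; apply/andP; split; apply/implyP => bD.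
    have /forallP/(_ b)/implyP := row [` bD].
    rewrite -[X in tab_val m X]/(val [` bD]) tab_val_in; apply.
    by rewrite /= eqxx gerBl.
  have /forallP/(_ [` bD])/implyP := col b.
  rewrite -[X in tab_val m X]/(val [` bD]) tab_val_in; apply.
  by rewrite /= eqxx ltrDl.
have okD b : b \in D -> tab_ok (tab_val m) b by move=> bD; apply: (ok [` bD]).
have row (d : nat) r c : (r, c) \in D -> (r, c + d%:Z) \in D ->
    (tab_val m (r, c) <= tab_val m (r, (c + d%:Z)%R))%N.
  elim: d => [|d IH] b1 b2; first by rewrite addr0.
  have b3 : (r, c + d%:Z) \in D by apply: (Dconvex b1 b2) => /=; lia.
  apply: leq_trans (IH b1 b3) _; have /and3P[_ + _] := okD _ b2.
  by rewrite /left_box /= (_ : c + d.+1%:Z - 1 = c + d%:Z) ?b3 //; lia.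
have col (d : nat) r c : (r, c) \in D -> (r + d.+1%:Z, c) \in D ->
    (tab_val m (r, c) < tab_val m ((r + d.+1%:Z)%R, c))%N.
  elim: d => [|d IH] b1 b2.
    have /and3P[_ _] := okD _ b1.
    by rewrite /below_box /= b2.
  have b3 : (r + d.+1%:Z, c) \in D by apply: (Dconvex b1 b2) => /=; lia.
  apply: ltn_trans (IH b1 b3) _; have /and3P[_ _] := okD _ b3.
  by rewrite /below_box /= (_ : r + d.+1%:Z + 1 = r + d.+2%:Z) ?b2 //; lia.
split; apply/forallP => b; first by have /and3P[] := ok b; rewrite tab_val_in.
  apply/forallP => b'; apply/implyP => /andP[/eqP b1 b2].
  rewrite -!tab_val_in; case: b b' b1 b2 => [[r c] bD] [[r' c'] bD'] /= E le2.
  subst r'; have := row `|c' - c|%N r c bD.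
  by rewrite (_ : c + `|c' - c|%N%:Z = c'); [apply | lia].
apply/forallP => b'; apply/implyP => /andP[/eqP b1 b2].
rewrite -!tab_val_in; case: b b' b1 b2 => [[r c] bD] [[r' c'] bD'] /= E lt2.
subst c'; have := col `|r' - r|%N.-1 r c bD.
by rewrite (_ : r + `|r' - r|%N.-1.+1%:Z = r'); [apply | lia].
Qed.

End StripSystem.

Lemma zeta_trunc_det (R : realType) (D : {fset box}) (n : nat) (rho : int -> int)
    (t p q : 'I_n -> int) (k : box -> nat) (kc : int -> nat) (M : nat) :
  convex D ->
  (forall c, rho (c + 1) = rho c \/ rho (c + 1) = rho c - 1) ->
  (forall b : box, b \in D <->
    exists i, alive p q i (box_content b) /\ b.1 = rho (box_content b) - t i) ->
  (forall i j c, alive p q i c || alive p q i (c + 1) ->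
    alive p q j c || alive p q j (c + 1) -> t i = t j -> i = j) ->
  (forall i, p i <= q i) ->
  (forall b, b \in D -> k b = kc (box_content b)) ->
  zeta_trunc R D k M.+1 =
  \det (\matrix_(i, j)
    strip_sum M.+1 (fun c m => m%:R ^- kc c) rho (p i) (q j)).
Proof.
move=> Dc rhoS DP' inj pq kE.
have DP b := iffP idP (DP' b).1 (DP' b).2.
rewrite -(tableau_sum_det Dc rhoS DP inj pq).
apply: eq_big => [m|m _]; first by rewrite (is_ssytE Dc).
by apply: eq_bigr => b _; rewrite kE ?(valP b).
Qed.

(** * Logarithmic asymptotics *)

Section LogAsymptotics.
Variable R : realType.
Implicit Types (e s u v : nat -> R) (b M N : nat).

Lemma pos_sum1 (f : nat -> R) : \sum_(b < 1 | (0 < b)%N) f b = 0.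
Proof. by rewrite big_mkcond big_ord_recl big_ord0 /= addr0. Qed.

Lemma pos_sumS (f : nat -> R) N : (0 < N)%N ->
  \sum_(b < N.+1 | (0 < b)%N) f b = \sum_(b < N | (0 < b)%N) f b + f N.
Proof. by move=> N0; rewrite big_mkcond big_ord_recr /= N0 -big_mkcond. Qed.

(** Adding 1 keeps the base at least 1 already at [b = 1]: powers increase with the exponent, and
    error bounds hold for every positive argument rather than eventually. *)
Definition log1 (b : nat) : R := 1 + ln b%:R.

Lemma ln_nat_ge0 b : (0 < b)%N -> 0 <= ln (b%:R : R).
Proof. by move=> b0; rewrite ln_ge0 // ler1n. Qed.

Lemma log1_ge1 b : (0 < b)%N -> 1 <= log1 b.
Proof. by move=> b0; rewrite lerDl ln_nat_ge0. Qed.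

Lemma log1_ge0 b : (0 < b)%N -> 0 <= log1 b.
Proof. by move=> /log1_ge1; apply: le_trans. Qed.

Lemma ln_step_le b : (0 < b)%N -> ln (b.+1%:R : R) - ln b%:R <= b%:R^-1.
Proof.
move=> b0; have bR : (0 : R) < b%:R by rewrite ltr0n.
rewrite lerBlDl -lerBlDl -ln_div ?posrE ?ltr0n //.
rewrite (_ : b.+1%:R / b%:R = 1 + b%:R^-1).
  by apply: le_ln1Dx; apply: lt_trans (_ : 0 < _); rewrite ?oppr_lt0 ?invr_gt0.
by rewrite -addn1 natrD mulrDl divff ?gt_eqF // mul1r.
Qed.

Lemma ln_step_ge b : (0 < b)%N -> b.+1%:R^-1 <= ln (b.+1%:R : R) - ln b%:R.
Proof.
move=> b0; have bR : (0 : R) < b%:R by rewrite ltr0n.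
have b1R : (0 : R) < b.+1%:R by rewrite ltr0n.
rewrite -lerN2 opprB -ln_div ?posrE //.
rewrite (_ : b%:R / b.+1%:R = 1 + - b.+1%:R^-1).
  by apply: le_ln1Dx; rewrite ltrN2 invf_lt1 // ltr1n.
by rewrite (_ : b%:R = b.+1%:R - 1) ?mulrBl ?divff ?mul1r ?gt_eqF // -addn1 natrD addrK.
Qed.

Lemma invn_step_le b : (0 < b)%N ->
  b%:R^-1 - b.+1%:R^-1 <= (b%:R ^- 2 : R) /\ (b%:R ^- 2 : R) / 2 <= b%:R^-1 - b.+1%:R^-1.
Proof.
move=> b0; have bR : (1 : R) <= b%:R by rewrite ler1n.
have -> : (b%:R^-1 - b.+1%:R^-1 : R) = (b%:R * b.+1%:R)^-1.
  by rewrite -addn1 natrD; field; apply/andP; split; lra.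
have -> : (b%:R ^- 2 : R) / 2 = (b%:R * (2 * b%:R))^-1.
  by field; lra.
by rewrite expr2 -addn1 natrD; split; rewrite lef_pV2 ?posrE; nra.
Qed.

Lemma exprB_le (x y : R) n : 0 <= y -> y <= x ->
  x ^+ n.+1 - y ^+ n.+1 <= n.+1%:R * (x - y) * x ^+ n.
Proof.
move=> y0 yx; elim: n => [|n IH]; first by rewrite !expr1 expr0 mul1r mulr1.
have -> : x ^+ n.+2 - y ^+ n.+2 = (x - y) * x ^+ n.+1 + y * (x ^+ n.+1 - y ^+ n.+1).
  by rewrite !(exprS _ n.+1); ring.
have x0 : 0 <= x by lra.
have : y * (x ^+ n.+1 - y ^+ n.+1) <= x * (n.+1%:R * (x - y) * x ^+ n).
  apply: ler_pM => //; rewrite subr_ge0; exact: lerXn2r.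
rewrite -[n.+2]addn1 natrD exprS => h; set X := x ^+ n in h *.
by move: h; set Y := y * _; lra.
Qed.

(** An explicit telescoping majorant, by summation by parts: the decrement of
    [log1 b ^+ J.+1 / b%:R] is the wanted main term minus an error of order
    [log1 b ^+ J / b%:R ^+ 2], which the majorant for [J] absorbs. *)
Lemma log_tail_bound (J : nat) : exists (g : nat -> R) (C : R), 0 <= C /\
  forall b, (0 < b)%N -> log1 b ^+ J / b%:R ^+ 2 <= g b - g b.+1 /\
    0 <= g b <= C * log1 b ^+ J / b%:R.
Proof.
elim: J => [|J [g [C [C0 gC]]]].
  exists (fun b => 2 / b%:R), 2; split=> // b b0; rewrite !expr0 mulr1 div1r lexx andbT.
  split; last by rewrite divr_ge0.
  have [_] := invn_step_le b0; rewrite -mulrBr => h.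
  by rewrite -ler_pdivrMl // mulrC.
(* [J.+1] comes from the mean value estimate [exprB_le], and [2 ^+ J] from
   [log1 b.+1 <= 2 * log1 b]. *)
pose A : R := J.+1%:R * 2 ^+ J.
have A0 : 0 <= A by rewrite mulr_ge0 ?exprn_ge0.
exists (fun b => 2 * (log1 b ^+ J.+1 / b%:R) + 2 * A * g b), (2 + 2 * A * C).
split; first by rewrite addr_ge0 // !mulr_ge0.
move=> b b0; have [g1 /andP[g2 g3]] := gC b b0.
have bR : (0 : R) < b%:R by rewrite ltr0n.
have b1R : (0 : R) < b.+1%:R by rewrite ltr0n.
have l0 := log1_ge1 b0; have l1 := @log1_ge1 b.+1 isT.
have lle : log1 b <= log1 b.+1 by rewrite lerD2l ler_ln ?posrE // ler_nat.
have lstep : log1 b.+1 - log1 b <= b%:R^-1.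
  by rewrite /log1 opprD addrACA subrr add0r ln_step_le.
have binv1 : (b%:R : R)^-1 <= 1 by rewrite invf_le1 // ler1n.
have binv0 : 0 <= (b%:R : R)^-1 by rewrite invr_ge0 ltW.
have lp0 : 0 <= log1 b ^+ J by rewrite exprn_ge0 //; lra.
have lp1 : log1 b ^+ J <= log1 b ^+ J.+1.
  by rewrite exprS -[leLHS]mul1r ler_wpM2r.
split; last first.
  apply/andP; split.
    by rewrite addr_ge0 // !mulr_ge0 // (le_trans lp0).
  rewrite -[leRHS]mulrA [leRHS]mulrDl lerD2l -!mulrA; do 3!apply: ler_wpM2l => //.
  apply: le_trans g3 _; rewrite -mulrA; apply: ler_wpM2l => //.
  by apply: ler_wpM2r.
have key : (log1 b.+1 ^+ J.+1 - log1 b ^+ J.+1) / b.+1%:R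
    <= A * (log1 b ^+ J / b%:R ^+ 2).
  have h1 : log1 b.+1 ^+ J.+1 - log1 b ^+ J.+1 <= A * (log1 b ^+ J / b%:R).
    apply: le_trans (exprB_le J _ lle) _; first by lra.
    have xJ : log1 b.+1 ^+ J <= 2 ^+ J * log1 b ^+ J.
      by rewrite -exprMn lerXn2r ?nnegrE; lra.
    have : (log1 b.+1 - log1 b) * log1 b.+1 ^+ J <= b%:R^-1 * (2 ^+ J * log1 b ^+ J).
      by rewrite ler_pM ?exprn_ge0 //; lra.
    move=> /(ler_wpM2l (ler0n R J.+1)) h; rewrite -mulrA; apply: le_trans h _.
    by rewrite le_eqVlt; apply/orP; left; apply/eqP; rewrite /A; ring.
  apply: (@le_trans _ _ (A * (log1 b ^+ J / b%:R) / b.+1%:R)).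
    by rewrite ler_wpM2r // invr_ge0 ltW.
  rewrite -mulrA ler_wpM2l // -mulrA ler_wpM2l // expr2 invfM ler_wpM2l //.
  by rewrite lef_pV2 ?posrE // ler_nat.
have [_ h2] := invn_step_le b0.
have h3 : log1 b ^+ J.+1 * (b%:R ^- 2 / 2) <= log1 b ^+ J.+1 * (b%:R^-1 - b.+1%:R^-1).
  by apply: ler_wpM2l => //; apply: le_trans lp1.
have alg (X Y u v w Aa L gb gb1 : R) : (Y - X) * v <= Aa * (L * w) ->
    Aa * (L * w) <= Aa * (gb - gb1) -> X * (w / 2) <= X * (u - v) ->
    X * w <= (2 * (X * u) + 2 * Aa * gb) - (2 * (Y * v) + 2 * Aa * gb1) by lra.
exact: alg key (ler_wpM2l A0 g1) h3.
Qed.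

Definition log_small (e : nat -> R) : Prop := exists (C : R) (J : nat), 0 <= C /\
  forall M, (0 < M)%N -> `|e M| <= C * log1 M ^+ J / M%:R.

Definition log_bounded (s : nat -> R) : Prop := exists (C : R) (J : nat), 0 <= C /\
  forall M, (0 < M)%N -> `|s M| <= C * log1 M ^+ J.

Definition log_asymp (s : nat -> R) (P : {poly R}) : Prop :=
  log_small (fun M => s M - P.[ln M%:R]).

Definition log_poly (s : nat -> R) : Prop := exists P, log_asymp s P.

(* Comparison with [C g], which has nonnegative decrements dominating [u], makes
   the partial sums shifted by [+C g] and [-C g] monotone; they enclose the sum
   of the series. *)
Lemma log_series_tail (u : nat -> R) (C : R) (J : nat) :
  (forall b, (0 < b)%N -> `|u b| <= C * log1 b ^+ J / b%:R ^+ 2) ->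
  exists S : R, log_small (fun N => \sum_(b < N | (0 < b)%N) u b - S).
Proof.
move=> uC; have [g [C1 [C10 gC]]] := log_tail_bound J.
pose K : R := `|C|.
have uK b : (0 < b)%N -> `|u b| <= K * (g b - g b.+1).
  move=> b0; have [g1 _] := gC b b0; have := uC b b0; move=> /le_trans; apply.
  rewrite -mulrA; apply: le_trans (ler_wpM2l (normr_ge0 C) g1).
  apply: ler_wpM2r; last exact: ler_norm.
  by rewrite divr_ge0 ?exprn_ge0 ?log1_ge0.
have Kg0 b : (0 < b)%N -> 0 <= K * g b.
  by move=> b0; have [_ /andP[]] := gC b b0 => g0 _; apply: mulr_ge0 g0; apply: normr_ge0.
pose U N := \sum_(b < N | (0 < b)%N) u b.
have US N : (0 < N)%N -> U N.+1 = U N + u N.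
  exact: pos_sumS.
have mono N d : (0 < N)%N -> `|U (N + d)%N - U N| <= K * g N - K * g (N + d)%N.
  move=> N0; elim: d => [|d IH]; first by rewrite addn0 !subrr normr0.
  have Nd : (0 < N + d)%N by rewrite addn_gt0 N0.
  rewrite addnS US // addrAC; apply: le_trans (ler_normD _ _) _.
  have := uK _ Nd; rewrite mulrBr => h.
  by move: IH h; lra.
have encl M N : (0 < M)%N -> (0 < N)%N -> U M - K * g M <= U N + K * g N.
  move=> M0 N0; have := Kg0 _ M0; have := Kg0 _ N0.
  have [MN|/ltnW NM] := leqP M N.
    by have := mono _ (N - M)%N M0; rewrite subnKC // ler_norml; lra.
  by have := mono _ (M - N)%N N0; rewrite subnKC // ler_norml; lra.
pose E : set R := [set U N - K * g N | N in [set N | (0 < N)%N]]%classic.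
have EN0 : (E !=set0)%classic by exists (U 1%N - K * g 1%N), 1%N.
have Eub N : (0 < N)%N -> ubound E (U N + K * g N).
  by move=> N0 _ [M M0 <-]; apply: encl.
exists (sup E), (K * C1), J; split=> [|N N0]; first by rewrite mulr_ge0 ?normr_ge0.
have h1 : U N - K * g N <= sup E.
  apply: sup_upper_bound; last by exists N.
  by split=> //; exists (U 1%N + K * g 1%N); apply: Eub.
have h2 : sup E <= U N + K * g N by apply: ge_sup => //; apply: Eub.
have [_ /andP[_ g3]] := gC N N0.
have := ler_wpM2l (normr_ge0 C) g3; rewrite -/K !mulrA => h3.
by apply: le_trans h3; rewrite -/(U N) ler_norml; lra.
Qed.

(** * The ring of sequences with polynomial asymptotics in the logarithm *)

Lemma log1X_le M m n : (0 < M)%N -> (m <= n)%N -> log1 M ^+ m <= log1 M ^+ n.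
Proof. by move=> M0 mn; rewrite ler_weXn2l // log1_ge1. Qed.

Lemma eq_log_small e e' : (forall M, (0 < M)%N -> e M = e' M) ->
  log_small e -> log_small e'.
Proof.
by move=> ee' [C [J [C0 h]]]; exists C, J; split=> // M M0; rewrite -ee' // h.
Qed.

Lemma log_small_bounded e : log_small e -> log_bounded e.
Proof.
move=> [C [J [C0 h]]]; exists C, J; split=> // M M0; apply: le_trans (h M M0) _.
rewrite ler_piMr ?mulr_ge0 ?exprn_ge0 ?log1_ge0 // invf_le1 ?ltr0n //.
by rewrite ler1n.
Qed.

Lemma log_smallM s e : log_bounded s -> log_small e ->
  log_small (fun M => s M * e M).
Proof.
move=> [C [J [C0 h]]] [C' [J' [C'0 h']]]; exists (C * C'), (J + J')%N.
split=> [|M M0]; first exact: mulr_ge0.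
have -> : C * C' * log1 M ^+ (J + J') / M%:R =
    (C * log1 M ^+ J) * (C' * log1 M ^+ J' / M%:R) by rewrite exprD; ring.
by rewrite normrM ler_pM ?h ?h'.
Qed.

Lemma log_smallD e e' : log_small e -> log_small e' ->
  log_small (fun M => e M + e' M).
Proof.
move=> [C [J [C0 h]]] [C' [J' [C'0 h']]]; exists (C + C'), (J + J')%N.
split=> [|M M0]; first exact: addr_ge0.
apply: le_trans (ler_normD _ _) _; rewrite -mulrA mulrDl.
apply: lerD.
  apply: le_trans (h M M0) _; rewrite -mulrA ler_wpM2l // ler_wpM2r ?invr_ge0 //.
  by rewrite log1X_le // leq_addr.
apply: le_trans (h' M M0) _; rewrite -mulrA ler_wpM2l // ler_wpM2r ?invr_ge0 //.
by rewrite log1X_le // leq_addl.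
Qed.

Lemma log_boundedD s s' : log_bounded s -> log_bounded s' ->
  log_bounded (fun M => s M + s' M).
Proof.
move=> [C [J [C0 h]]] [C' [J' [C'0 h']]]; exists (C + C'), (J + J')%N.
split=> [|M M0]; first exact: addr_ge0.
apply: le_trans (ler_normD _ _) _; rewrite mulrDl; apply: lerD.
  by apply: le_trans (h M M0) _; rewrite ler_wpM2l // log1X_le // leq_addr.
by apply: le_trans (h' M M0) _; rewrite ler_wpM2l // log1X_le // leq_addl.
Qed.

Lemma horner_ln_bounded (P : {poly R}) : log_bounded (fun M => P.[ln M%:R]).
Proof.
elim/poly_ind: P => [|P c [C [J [C0 h]]]].
  by exists 0, 0%N; split=> // M _; rewrite horner0 normr0 mul0r.
exists (C + `|c|), J.+1; split=> [|M M0]; first by rewrite addr_ge0.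
rewrite hornerMXaddC; apply: le_trans (ler_normD _ _) _; rewrite mulrDl.
apply: lerD; last by rewrite ler_peMr // exprn_ege1 // log1_ge1.
rewrite normrM exprSr mulrA; apply: ler_pM => //; first exact: h.
by rewrite ger0_norm ?ln_nat_ge0 // lerDr.
Qed.

Lemma log_small0 : log_small (fun=> 0).
Proof. by exists 0, 0%N; split=> // M M0; rewrite normr0 !mul0r. Qed.

Lemma log_poly_bounded s : log_poly s -> log_bounded s.
Proof.
move=> [P /log_small_bounded h].
have [C [J [C0 hC]]] := log_boundedD h (horner_ln_bounded P).
by exists C, J; split=> // M M0; have := hC M M0; rewrite subrK.
Qed.

Lemma eq_log_poly s s' : (forall M, (0 < M)%N -> s M = s' M) ->
  log_poly s -> log_poly s'.
Proof.
by move=> ss' [P h]; exists P; apply: eq_log_small h => M M0; rewrite ss'.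
Qed.

Lemma log_poly_horner (P : {poly R}) : log_poly (fun M => P.[ln M%:R]).
Proof. by exists P; apply: eq_log_small log_small0 => M _; rewrite subrr. Qed.


Lemma log_poly_small e : log_small e -> log_poly e.
Proof. by move=> h; exists 0; apply: eq_log_small h => M _; rewrite horner0 subr0. Qed.

Lemma log_asympD s s' P P' : log_asymp s P -> log_asymp s' P' ->
  log_asymp (fun M => s M + s' M) (P + P').
Proof.
move=> h h'; apply: eq_log_small (log_smallD h h') => M _.
by rewrite hornerD opprD addrACA.
Qed.

Lemma log_asympM s s' P P' : log_asymp s P -> log_asymp s' P' ->
  log_asymp (fun M => s M * s' M) (P * P').
Proof.
move=> h h'; have bs : log_bounded s by apply: log_poly_bounded; exists P.
have := log_smallD (log_smallM bs h') (log_smallM (horner_ln_bounded P') h).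
by apply: eq_log_small => M _; rewrite hornerM; ring.
Qed.

Lemma log_asymp_const c : log_asymp (fun=> c) c%:P.
Proof. by apply: eq_log_small log_small0 => M _; rewrite hornerC subrr. Qed.

Lemma log_poly_const c : log_poly (fun=> c).
Proof. by exists c%:P; apply: log_asymp_const. Qed.

Lemma log_polyD s s' : log_poly s -> log_poly s' -> log_poly (fun M => s M + s' M).
Proof. by move=> [P h] [P' h']; exists (P + P'); apply: log_asympD. Qed.

Lemma log_polyM s s' : log_poly s -> log_poly s' -> log_poly (fun M => s M * s' M).
Proof. by move=> [P h] [P' h']; exists (P * P'); apply: log_asympM. Qed.

Lemma log_poly_sum (I : Type) (r : seq I) (A : pred I) (F : I -> nat -> R) :
  (forall i, log_poly (F i)) -> log_poly (fun M => \sum_(i <- r | A i) F i M).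
Proof.
move=> gF; elim: r => [|i r IH].
  by apply: eq_log_poly (log_poly_const 0) => M _; rewrite big_nil.
case Ai: (A i).
  by apply: eq_log_poly (log_polyD (gF i) IH) => M _; rewrite big_cons Ai.
by apply: eq_log_poly IH => M _; rewrite big_cons Ai.
Qed.

(** A Taylor remainder with a constant uniform in [c], to be applied at [c = ln b] and
    [h = ln (b + 1) - ln b]. *)
Lemma exprD_second_order n : exists2 K : R, 0 <= K & forall c h : R, 0 <= c -> 0 <= h <= 1 ->
  0 <= (c + h) ^+ n.+1 - c ^+ n.+1 - n.+1%:R * h * c ^+ n <= K * h ^+ 2 * (1 + c) ^+ n.
Proof.
elim: n => [|n [K K0 IH]].
  by exists 0 => // c h _ _; rewrite !expr1 !expr0 !mul0r; lra.
exists (K + n.+1%:R) => [|c h c0 h01]; first by rewrite addr_ge0.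
have := IH c h c0 h01.
set E := _ - _ - _ => /andP[E0 EK].
have -> : (c + h) ^+ n.+2 - c ^+ n.+2 - n.+2%:R * h * c ^+ n.+1 =
    (c + h) * E + n.+1%:R * (h ^+ 2 * c ^+ n).
  by rewrite /E !exprS; ring.
have cn0 : 0 <= c ^+ n by rewrite exprn_ge0.
have cn1 : c ^+ n <= (1 + c) ^+ n.+1.
  apply: (@le_trans _ _ ((1 + c) ^+ n)); first by rewrite lerXn2r ?nnegrE; lra.
  by apply: ler_weXn2l => //; lra.
have h2 : 0 <= h ^+ 2 by rewrite exprn_ge0; lra.
apply/andP; split; first by rewrite addr_ge0 // !mulr_ge0 //; lra.
have -> : (K + n.+1%:R) * h ^+ 2 * (1 + c) ^+ n.+1 =
    (1 + c) * (K * h ^+ 2 * (1 + c) ^+ n) + n.+1%:R * (h ^+ 2 * (1 + c) ^+ n.+1).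
  by rewrite !exprS; ring.
apply: lerD; first by apply: ler_pM => //; lra.
by rewrite !ler_wpM2l.
Qed.

(** Compared with the increments of [ln ^ (a + 1) / (a + 1)], the terms leave a summable error. The
    increments telescope to the leading monomial, and the constant [S] is the Stieltjes constant of
    index [a]. *)
Lemma log_poly_harmonic_power (a : nat) :
  log_poly (fun N => \sum_(b < N | (0 < b)%N) ln b%:R ^+ a / b%:R).
Proof.
have [K K0 hK] := exprD_second_order a.
have alg (U V X w : R) : 0 <= U <= X * w -> 0 <= V <= K * (w * X) ->
    `|U - V| <= (1 + K) * X * w by rewrite ler_norml; nra.
pose Q (x : R) := x ^+ a.+1 / a.+1%:R.
pose u (b : nat) : R := ln b%:R ^+ a / b%:R - (Q (ln b.+1%:R) - Q (ln b%:R)).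
have uE b : (0 < b)%N -> `|u b| <= (1 + K) * log1 b ^+ a / b%:R ^+ 2.
  move=> b0; have bR : (0 : R) < b%:R by rewrite ltr0n.
  have aR : (0 : R) < a.+1%:R by rewrite ltr0n.
  have c0 := ln_nat_ge0 b0; have l1 := ln_step_le b0; have l2 := ln_step_ge b0.
  have [l3 _] := invn_step_le b0.
  have b1R : (0 : R) <= b.+1%:R^-1 by rewrite invr_ge0.
  have binv1 : (b%:R : R)^-1 <= 1 by rewrite invf_le1 // ler1n.
  pose h := ln (b.+1%:R : R) - ln b%:R.
  have bh : ln b.+1%:R = ln b%:R + h by rewrite /h addrC subrK.
  have hb : h <= b%:R^-1 by [].
  have hb2 : b%:R^-1 - h <= b%:R ^- 2 by apply: le_trans l3; rewrite lerD2l lerN2.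
  have h0 : 0 <= h by apply: le_trans b1R l2.
  have h01 : 0 <= h <= 1 by rewrite h0 (le_trans hb).
  clearbody h; clear l1 l2 l3.
  have := hK (ln b%:R) h c0 h01; rewrite -bh.
  set E := _ - _ - _ => /andP[E0 EK].
  have -> : u b = ln b%:R ^+ a * (b%:R^-1 - h) - E / a.+1%:R.
    by rewrite /u /Q /E; field; rewrite gt_eqF // gt_eqF.
  have h2 : h ^+ 2 <= b%:R ^- 2 by rewrite -exprVn lerXn2r ?nnegrE ?invr_ge0.
  have ca : ln b%:R ^+ a <= log1 b ^+ a.
    by rewrite lerXn2r ?nnegrE ?log1_ge0 // lerDr.
  have t1 : 0 <= ln b%:R ^+ a * (b%:R^-1 - h) <= log1 b ^+ a * b%:R ^- 2.
    apply/andP; split; first by rewrite mulr_ge0 ?exprn_ge0 ?subr_ge0.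
    by rewrite ler_pM ?exprn_ge0 ?subr_ge0.
  have t2 : 0 <= E / a.+1%:R <= K * (b%:R ^- 2 * log1 b ^+ a).
    apply/andP; split; first by rewrite divr_ge0 // ltW.
    apply: (@le_trans _ _ E).
      by rewrite ler_pdivrMr // ler_peMr // ler1n.
    apply: le_trans EK _; rewrite -mulrA ler_wpM2l // ler_wpM2r //.
    by rewrite exprn_ge0 // log1_ge0.
  exact: alg t1 t2.
have [S sm] := log_series_tail uE.
have := log_polyD (log_polyD (log_poly_small sm) (log_poly_const S))
  (log_poly_horner (a.+1%:R^-1 *: 'X^(a.+1))).
apply: eq_log_poly => N N0; rewrite subrK hornerZ hornerXn.
elim: N N0 => // N IH _; case: N IH => [_|N IH].
  by rewrite (pos_sum1 u) (pos_sum1 (fun b => ln b%:R ^+ a / b%:R)) ln1 expr0n mulr0 addr0.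
rewrite (pos_sumS u) // (pos_sumS (fun b => ln b%:R ^+ a / b%:R)) // -IH // {2}/u /Q.
by ring.
Qed.

(** Only exponent 1 can diverge: there the polynomial part of [s] reduces to harmonic power sums,
    and its error divided by [b] is summable. For larger exponents logarithmic growth of [s] already
    gives convergence. *)
Lemma log_poly_sum_div s (k : nat) : (0 < k)%N -> log_poly s ->
  log_poly (fun N => \sum_(b < N | (0 < b)%N) b%:R ^- k * s b).
Proof.
have conv u : (exists C J, forall b, (0 < b)%N -> `|u b| <= C * log1 b ^+ J / b%:R ^+ 2) ->
    log_poly (fun N => \sum_(b < N | (0 < b)%N) u b).
  move=> [C [J uC]]; have [S sm] := log_series_tail uC.
  apply: eq_log_poly (log_polyD (log_poly_small sm) (log_poly_const S)) => M _.
  by rewrite subrK.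
case: k => // -[_ [P [C [J [C0 h]]]]|k _ gs].
  pose e b := s b - P.[ln b%:R].
  have := log_polyD (conv (fun b => e b / b%:R) _)
    (log_poly_sum (index_enum 'I_(size P)) xpredT (fun i => log_polyM (log_poly_const P`_i) (log_poly_harmonic_power i))).
  move=> /(_ _)/wrap[].
    exists C, J => b b0; rewrite normrM expr2 invfM mulrA.
    by rewrite [X in _ * X]ger0_norm ?invr_ge0 // ler_wpM2r ?invr_ge0 // h.
  apply: eq_log_poly => N _.
  under [X in _ + X]eq_bigr do rewrite mulr_sumr.
  rewrite exchange_big -big_split /=; apply: eq_bigr => b _.
  rewrite /e expr1 horner_coef.
  under [X in _ + X]eq_bigr do rewrite mulrA.
  by rewrite -mulr_suml -mulrDl subrK mulrC.
apply: (conv (fun b => b%:R ^- k.+2 * s b)).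
have [C [J [C0 h]]] := log_poly_bounded gs.
exists C, J => b b0; rewrite normrM mulrC; apply: ler_pM => //; first exact: h.
rewrite ger0_norm ?invr_ge0 ?exprn_ge0 // lef_pV2 ?posrE ?exprn_gt0 ?ltr0n //.
by rewrite ler_weXn2l // ler1n.
Qed.

End LogAsymptotics.

(** * Regularization of path sums *)

Section StripAsymptotics.
Variable R : realType.

Lemma log_asymp_sum (I : Type) (r : seq I) (F : I -> nat -> R) (P : I -> {poly R}) :
  (forall i, log_asymp (F i) (P i)) ->
  log_asymp (fun M => \sum_(i <- r) F i M) (\sum_(i <- r) P i).
Proof.
move=> h; elim: r => [|i r IH].
  by rewrite big_nil; apply: eq_log_small (log_asymp_const 0) => M _; rewrite big_nil.
by rewrite big_cons; apply: eq_log_small (log_asympD (h i) IH) => M _; rewrite big_cons.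
Qed.

Lemma log_asymp_prod (I : Type) (r : seq I) (F : I -> nat -> R) (P : I -> {poly R}) :
  (forall i, log_asymp (F i) (P i)) ->
  log_asymp (fun M => \prod_(i <- r) F i M) (\prod_(i <- r) P i).
Proof.
move=> h; elim: r => [|i r IH].
  by rewrite big_nil; apply: eq_log_small (log_asymp_const 1) => M _; rewrite big_nil.
by rewrite big_cons; apply: eq_log_small (log_asympM (h i) IH) => M _; rewrite big_cons.
Qed.

Lemma log_asymp_det (n : nat) (E : 'I_n -> 'I_n -> nat -> R)
    (P : 'I_n -> 'I_n -> {poly R}) : (forall i j, log_asymp (E i j) (P i j)) ->
  log_asymp (fun M => \det (\matrix_(i, j) E i j M)) (\det (\matrix_(i, j) P i j)).
Proof.
move=> h; apply: log_asymp_sum => s.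
have := log_asympM (log_asymp_const ((-1) ^+ s))
  (log_asymp_prod (index_enum 'I_n) (fun i => h i (s i))).
rewrite polyC_exp polyCN.
under [in X in _ -> log_asymp _ X]eq_bigr => i _ do rewrite mxE.
apply: eq_log_small => M _; congr (_ * _ - _).
by apply: eq_bigr => i _; rewrite mxE.
Qed.

(* Finite sums of products [u M * v a]: this form is preserved by the summations
   over [a <= b < M] and over [b < a]. *)
Inductive separated : (nat -> nat -> R) -> Prop :=
| separated_mul u v : log_poly u -> log_poly v -> separated (fun M a => u M * v a)
| separated_add F G : separated F -> separated G ->
    separated (fun M a => F M a + G M a)
| separated_ext F G : (forall M a, (a < M)%N -> F M a = G M a) ->
    separated F -> separated G.

Variables (kc : int -> nat) (rho : int -> int).
Hypothesis kc_gt0 : forall c, (0 < kc c)%N.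
Let x (c : int) (m : nat) : R := m%:R ^- kc c.

Lemma separated_sum F c : separated F ->
  log_poly (fun M => \sum_(b < M | (0 < b)%N) x c b * F M b).
Proof.
elim=> {F} [u v hu hv|F G _ IF _ IG|F G FG _ IF].
- apply: eq_log_poly (log_polyM hu (log_poly_sum_div (kc_gt0 c) hv)) => M _.
  by rewrite mulr_sumr; apply: eq_bigr => b _; rewrite mulrCA.
- apply: eq_log_poly (log_polyD IF IG) => M _; rewrite -big_split /=.
  by apply: eq_bigr => b _; rewrite mulrDr.
- by apply: eq_log_poly IF => M _; apply: eq_bigr => b _; rewrite FG.
Qed.

Lemma separated_step F c c' : separated F ->
  separated (fun M a =>
    \sum_(b < M | (0 < b)%N && step_rel rho c a b) x c' b * F M b).
Proof.
elim=> {F} [u v hu hv|F G _ IF _ IG|F G FG _ IF].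
- pose sg N := \sum_(b < N | (0 < b)%N) x c' b * v b.
  have hsg : log_poly sg := log_poly_sum_div (kc_gt0 c') hv.
  (* Here the restriction [a < M] in [separated_ext] matters: the sum over [b < a] is not cut off by
     [M]. *)
  have lowE M a : (a < M)%N ->
      \sum_(b < M | (0 < b)%N && (b < a)%N) x c' b * v b = sg a.
    move=> aM; symmetry.
    exact: (big_ord_widen_cond M (fun b => 0 < b)%N (fun b => x c' b * v b) (ltnW aM)).
  case E: (rho (c + 1) == rho c).
    (* The sum over [a <= b < M] is the full sum minus the sum over [b < a], hence two products. *)
    apply: (separated_ext (F := fun M a => u M * sg M * 1 + (-1 * u M) * sg a)).
      move=> M a aM; rewrite -(lowE _ _ aM) mulr1 mulN1r mulNr -mulrBr.
      rewrite /sg (bigID (fun b : 'I_M => (b < a)%N)) /= addrAC subrr add0r mulr_sumr.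
      apply: eq_big => [b|b _]; last by rewrite mulrCA.
      by rewrite /step_rel E -leqNgt.
    apply: separated_add; apply: separated_mul => //.
    - exact: log_polyM.
    - exact: log_poly_const.
    - by apply: log_polyM => //; apply: log_poly_const.
  apply: (separated_ext (F := fun M a => u M * sg a)); last exact: separated_mul.
  move=> M a aM; rewrite -(lowE _ _ aM) mulr_sumr.
  apply: eq_big => [b|b _]; last by rewrite mulrCA.
  by rewrite /step_rel E.
- apply: separated_ext (separated_add IF IG) => M a _; rewrite -big_split /=.
  by apply: eq_bigr => b _; rewrite mulrDr.
- by apply: separated_ext IF => M a _; apply: eq_bigr => b _; rewrite FG.
Qed.

Lemma path_sum_separated l c : separated (fun M => path_sum M x rho l c).
Proof.
elim: l c => [|l IH] c /=; last exact: (separated_step c (c + 1) (IH (c + 1))).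
apply: separated_ext (separated_mul (log_poly_const 1) (log_poly_const 1)) => M a _.
by rewrite mulr1.
Qed.

Lemma strip_sum_log_poly p q : log_poly (fun M => strip_sum M x rho p q).
Proof.
rewrite /strip_sum /tail_sum; case: (p <= q); last exact: log_poly_const.
exact: (separated_sum p (path_sum_separated _ p)).
Qed.

End StripAsymptotics.

Section Regularization.
Variable R : realType.

(** For a perfect power [M = y ^ J.+1], the bound [ln y <= y] gives [ln M ^ J / M <= J.+1 ^ J / y].
    The two summands of [z] serve the lower bound on [ln M] and the smallness. *)
Lemma ln_powM_small (J : nat) (C : R) (e : R) (x0 : R) (N : nat) : 0 < e ->
  exists M, [/\ (N <= M)%N, x0 <= ln M%:R & C * (ln M%:R ^+ J / M%:R) < e].
Proof.
move=> e0.
pose z := `|x0| + `|C| * J.+1%:R ^+ J / e.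
have z0 : 0 <= z by rewrite addr_ge0 // divr_ge0 ?mulr_ge0 ?exprn_ge0 // ltW.
pose y := (Num.bound (expR z) + N).+1.
have y1 : (1 : R) <= y%:R by rewrite ler1n.
have yz : expR z < y%:R.
  apply: lt_le_trans (archi_boundP (ltW (expR_gt0 z))) _.
  by rewrite ler_nat /y -addnS leq_addr.
have y0 : (0 : R) < y%:R by rewrite ltr0n.
have lny : z < ln y%:R by rewrite -[ltLHS]expRK ltr_ln ?posrE ?expR_gt0.
have lny1 : ln (y%:R : R) <= y%:R.
  have := @le_ln1Dx R (y%:R - 1); rewrite addrCA subrr addr0 => h.
  by apply: le_trans (h _) _; lra.
have lnM : ln ((y ^ J.+1)%N%:R : R) = J.+1%:R * ln y%:R.
  by rewrite natrX lnXn // mulr_natl.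
exists (y ^ J.+1)%N; split.
- apply: (@leq_trans y); first by rewrite /y; lia.
  by rewrite -[leqLHS]expn1 leq_exp2l.
- rewrite lnM; apply: (@le_trans _ _ (ln y%:R)).
    apply: le_trans (ltW lny); rewrite /z; apply: le_trans (ler_norm x0) _.
    by rewrite lerDl divr_ge0 ?mulr_ge0 ?exprn_ge0 // ltW.
  by rewrite ler_peMl ?ler1n // ln_ge0.
- rewrite lnM natrX exprMn.
  have ub : J.+1%:R ^+ J * ln y%:R ^+ J / y%:R ^+ J.+1 <= (J.+1%:R ^+ J : R) / y%:R.
    rewrite -mulrA ler_wpM2l ?exprn_ge0 // exprS invfM mulrCA -[leRHS]mulr1.
    rewrite ler_wpM2l ?invr_ge0 ?(ltW y0) // ler_pdivrMr ?exprn_gt0 // mul1r.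
    by rewrite lerXn2r ?nnegrE ?ln_ge0 // ltW.
  have ub0 : 0 <= J.+1%:R ^+ J * ln y%:R ^+ J / y%:R ^+ J.+1 :> R.
    by rewrite divr_ge0 ?mulr_ge0 ?exprn_ge0 ?ln_ge0 // ltW.
  apply: (@le_lt_trans _ _ (`|C| * ((J.+1%:R ^+ J : R) / y%:R))).
    by apply: le_trans (ler_wpM2l (normr_ge0 C) ub); rewrite ler_wpM2r // ler_norm.
  rewrite mulrA ltr_pdivrMr // -ltr_pdivrMl //.
  apply: lt_le_trans lny1; apply: le_lt_trans lny.
  by rewrite mulrC /z lerDr.
Qed.

(** A nonzero polynomial, up to sign, eventually stays above its positive leading coefficient,
    whereas the error bound becomes arbitrarily small. *)
Lemma horner_ln_unique (P : {poly R}) (c : R) (J : nat) :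
  (fun M : nat => P.[ln M%:R + c] : R) =O_\oo (fun M : nat => ln M%:R ^+ J / M%:R : R) ->
  P = 0.
Proof.
wlog lcP : P / 0 <= lead_coef P.
  move=> W h; case: (lerP 0 (lead_coef P)) => lcP; first exact: W.
  apply/eqP; rewrite -oppr_eq0; apply/eqP; apply: W.
    by rewrite lead_coefN oppr_ge0 ltW.
  move: h => /eqO_exP [k k0 h]; apply/eqO_exP; exists k => //.
  by apply: filterS h => M; rewrite hornerN normrN.
move=> /eqO_exP [C C0 h]; apply/eqP; rewrite -lead_coef_eq0.
apply/negP => /negP lc0.
have {lc0}lc_gt0 : 0 < lead_coef P by rewrite lt_neqAle eq_sym lc0.
have [x0 hx0] := poly_pinfty_gt_lc lc_gt0.
case: h => N _ hN.
have [M [NM Mx Ms]] := ln_powM_small J C (x0 - c) N.+1 lc_gt0.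
have M1 : (0 < M)%N by apply: leq_trans NM.
have /= := hN M (ltnW NM).
have ge0 : 0 <= ln M%:R ^+ J / M%:R :> R.
  by rewrite divr_ge0 // exprn_ge0 // ln_ge0 // ler1n.
rewrite [X in _ * X]ger0_norm // => h1.
have h2 : lead_coef P <= P.[ln M%:R + c].
  by apply: hx0; move: Mx; rewrite lerBlDr.
have := lt_le_trans Ms (le_trans h2 (le_trans (ler_norm _) h1)).
by rewrite ltxx.
Qed.

(** Once [ln M] is at least 1, its powers increase with the exponent, as those of [log1] always do;
    this permits merging exponents and passing from [log1] to [ln]. *)
Lemma ln_ge1_near : exists N : nat, forall M, (N <= M)%N -> (0 < M)%N /\ 1 <= ln (M%:R : R).
Proof.
exists (Num.bound (expR (1 : R))).+1 => M NM; split; first exact: leq_trans NM.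
rewrite -[leLHS]expRK ler_ln ?posrE ?expR_gt0 ?ltr0n //; last exact: leq_trans NM.
apply/ltW/(lt_le_trans (archi_boundP (ltW (expR_gt0 1)))).
by rewrite ler_nat ltnW.
Qed.

Lemma is_regularization_unique (D : {fset box}) (k : box -> nat) (P Q : {poly R}) :
  is_regularization D k P -> is_regularization D k Q -> P = Q.
Proof.
move=> [J /eqO_exP [C C0 [N1 _ hP]]] [J' /eqO_exP [C' C'0 [N2 _ hQ]]].
apply/eqP; rewrite -subr_eq0; apply/eqP.
apply: (@horner_ln_unique _ (euler_gamma R) (J + J')).
apply/eqO_exP; exists (C + C'); first exact: addr_gt0.
have [N0 hN0] := ln_ge1_near.
exists (maxn N0 (maxn N1 N2)) => // M /=; rewrite !geq_max => /and3P[M0 M1 M2].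
have [Mpos lM] := hN0 M M0.
have /= h1 := hP M M1; have /= h2 := hQ M M2.
have le_pow i j : (i <= j)%N -> `|ln M%:R ^+ i / M%:R : R| <= `|ln M%:R ^+ j / M%:R : R|.
  have ln0 : 0 <= ln M%:R :> R by rewrite (le_trans _ lM).
  move=> ij; rewrite !ger0_norm ?divr_ge0 ?exprn_ge0 //.
  by rewrite ler_wpM2r ?invr_ge0 // ler_weXn2l.
rewrite hornerD hornerN.
have -> : P.[ln M%:R + euler_gamma R] - Q.[ln M%:R + euler_gamma R] =
    (zeta_trunc R D k M - Q.[ln M%:R + euler_gamma R]) -
    (zeta_trunc R D k M - P.[ln M%:R + euler_gamma R]) by ring.
apply: le_trans (ler_normB _ _) _; rewrite mulrDl addrC; apply: lerD.
  by apply: le_trans h1 _; rewrite ler_wpM2l ?le_pow ?leq_addr // ltW.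
by apply: le_trans h2 _; rewrite ler_wpM2l ?le_pow ?leq_addl // ltW.
Qed.

Lemma is_regularization_log_small (D : {fset box}) (k : box -> nat) (P : {poly R}) :
  log_asymp (zeta_trunc R D k) P ->
  is_regularization D k (P \Po ('X - (euler_gamma R)%:P)).
Proof.
(* [2 ^+ J] comes from [log1 M <= 2 * ln M] once [ln M >= 1]; the added 1 makes the constant
   positive. *)
move=> [C [J [C0 h]]]; exists J; apply/eqO_exP; exists (C * 2 ^+ J + 1).
  by rewrite ltr_wpDl // mulr_ge0 ?exprn_ge0.
have [N0 hN0] := ln_ge1_near; exists N0 => // M /= M0.
have [Mpos lM] := hN0 M M0.
rewrite horner_comp hornerXsubC addrK; apply: le_trans (h M Mpos) _.
have ln0 : 0 <= ln M%:R :> R by rewrite (le_trans _ lM).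
rewrite (@ger0_norm _ (ln M%:R ^+ J / M%:R)) ?divr_ge0 ?exprn_ge0 //.
rewrite mulrA ler_wpM2r ?invr_ge0 // mulrDl -mulrA -exprMn.
rewrite ler_wpDr ?mul1r ?exprn_ge0 //.
by rewrite ler_wpM2l // lerXn2r ?nnegrE ?log1_ge0 // /log1; lra.
Qed.

Lemma zeta_starP (D : {fset box}) (k : box -> nat) :
  log_poly (zeta_trunc R D k) -> is_regularization D k (zeta_star R D k).
Proof.
move=> [P /is_regularization_log_small hP].
by rewrite /zeta_star; case: xgetP => [_ -> //|/(_ _ hP)].
Qed.

Lemma zeta_starE (D : {fset box}) (k : box -> nat) (P : {poly R}) :
  log_asymp (zeta_trunc R D k) P ->
  zeta_star R D k = P \Po ('X - (euler_gamma R)%:P).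
Proof.
move=> hP; apply: (@is_regularization_unique D k); last exact: is_regularization_log_small.
by apply: zeta_starP; exists P.
Qed.

End Regularization.

(** * Ribbons and contents *)

Lemma partition_nth_le (s : seq nat) (i j : nat) :
  is_partition s -> (i <= j)%N -> (nth 0%N s j <= nth 0%N s i)%N.
Proof.
case/andP=> srt _ ij; case: (ltnP j (size s)) => js; last by rewrite nth_default.
apply: (sorted_leq_nth _ _ 0%N srt) => //.
- by move=> a b c ab ca; apply: leq_trans ca ab.
- exact: leqnn.
- by rewrite inE (leq_ltn_trans ij).
Qed.

Lemma in_skewP (lam mu : seq nat) (b : box) : reflect
  (exists i j : nat, b = (i.+1%:Z, j.+1%:Z) /\ (nth 0 mu i <= j < nth 0 lam i)%N)
  (b \in skew_diagram lam mu).
Proof.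
apply: (iffP (imfset2P _ _ _ _ _)) => [[i /= _ [j]]|[i [j [-> /andP[mj jl]]]]].
  by rewrite mem_iota => ij ->; exists i, j; split=> //; lia.
exists i; last by exists j => //; rewrite mem_iota; lia.
rewrite /= mem_iota /= add0n; case: (ltnP i (size lam)) => // il.
by rewrite nth_default in jl.
Qed.

Lemma skew_convex (lam mu : seq nat) :
  is_partition lam -> is_partition mu -> convex (skew_diagram lam mu).
Proof.
move=> Hl Hm x y [z1 z2] /in_skewP[i [j [-> /andP[h1 _]]]].
case/in_skewP=> i' [j' [-> /andP[_ h4]]] /= h5 h6.
apply/in_skewP; exists (absz (z1 - 1)), (absz (z2 - 1)); split.
  by congr (_, _); lia.
have := @partition_nth_le mu i (absz (z1 - 1)) Hm.
have := @partition_nth_le lam (absz (z1 - 1)) i' Hl; lia.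
Qed.

Lemma is_skew_convex (D : {fset box}) : is_skew_diagram D -> convex D.
Proof. by case=> lam [mu [Hl Hm _ ->]]; apply: skew_convex. Qed.

Lemma box_eq (b b' : box) : box_content b = box_content b' -> b.1 = b'.1 -> b = b'.
Proof.
case: b b' => b1 b2 [b1' b2']; rewrite /box_content /= => E b1E.
by congr (_, _); lia.
Qed.

Lemma edge_adjacent_content (a b : box) : edge_adjacent a b ->
  box_content b = box_content a + 1 \/ box_content a = box_content b + 1.
Proof.
by case: a b => a1 a2 [b1 b2]; rewrite /edge_adjacent /box_content /=; lia.
Qed.

Lemma edge_adjacent_sym (a b : box) : edge_adjacent a b = edge_adjacent b a.
Proof. by rewrite /edge_adjacent !(distrC a.1) !(distrC a.2). Qed.

Lemma adjacent_succ (a b : box) : edge_adjacent a b ->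
  box_content b = box_content a + 1 -> b.1 = a.1 \/ b.1 = a.1 - 1.
Proof.
by case: a b => a1 a2 [b1 b2]; rewrite /edge_adjacent /box_content /=; lia.
Qed.

(** A discrete intermediate value theorem: an edge changes the content by exactly one. *)
Lemma connected_crossing (D : {fset box}) (x y : box) (c : int) :
  edge_connected D -> x \in D -> y \in D ->
  box_content x <= c -> c < box_content y ->
  exists b b', [/\ b \in D, b' \in D, edge_adjacent b b', box_content b = c &
    box_content b' = c + 1].
Proof.
move=> conn xD yD; have /connectP[p] := conn [` xD] [` yD].
rewrite -[x in box_content x <= _]/(val [` xD]) -[y in _ < box_content y]/(val [` yD]).
move: [` xD] [` yD] => {xD yD} x' y'; elim: p x' => [|z p IH] x' /=.
  by move=> _ -> h1 h2; move: (le_lt_trans h1 h2); rewrite ltxx.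
case/andP=> xz zp ly xc cy; case: (lerP (box_content (val z)) c) => zc.
  exact: (IH z).
exists (val x'), (val z); split; rewrite ?(valP x') ?(valP z) //.
  by move: xc zc (edge_adjacent_content xz) => /=; lia.
by move: xc zc (edge_adjacent_content xz) => /=; lia.
Qed.

Lemma mem_contents (D : {fset box}) (b : box) :
  b \in D -> box_content b \in contents D.
Proof. by move=> bD; apply/imfsetP; exists b. Qed.

Section SortedContents.
Variable D : {fset box}.
Let s := sort <=%O (enum_fset (contents D)).

Let s_mem c : (c \in s) = (c \in contents D).
Proof. by rewrite mem_sort. Qed.

Let s_srt : sorted <=%O s.
Proof. exact/sort_sorted/le_total. Qed.

Let s_gt0 b : b \in D -> (0 < size s)%N.
Proof. by move/mem_contents; rewrite -s_mem; case: s. Qed.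

Lemma content_bounds b : b \in D -> min_content D <= box_content b <= max_content D.
Proof.
move=> bD; have s0 := s_gt0 bD.
have := mem_contents bD; rewrite -s_mem => /(nthP 0) [i il <-].
rewrite /min_content /max_content -/s -nth0 -nth_last.
have ip : (i <= (size s).-1)%N by rewrite -ltnS prednK.
by apply/andP; split; apply: (sorted_leq_nth le_trans le_refl 0 s_srt);
  rewrite // inE ?prednK.
Qed.

Lemma min_contentP : D != fset0 -> exists2 b, b \in D & box_content b = min_content D.
Proof.
case/fset0Pn=> b bD; have s0 := s_gt0 bD.
have : min_content D \in s by rewrite /min_content -/s -nth0 mem_nth.
by rewrite s_mem => /imfsetP[b' /= b'D ->]; exists b'.
Qed.

Lemma max_contentP : D != fset0 -> exists2 b, b \in D & box_content b = max_content D.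
Proof.
case/fset0Pn=> b bD; have s0 := s_gt0 bD.
have : max_content D \in s by rewrite /max_content -/s -nth_last mem_nth ?prednK.
by rewrite s_mem => /imfsetP[b' /= b'D ->]; exists b'.
Qed.

End SortedContents.

Lemma contents_interval (D : {fset box}) (c : int) : edge_connected D -> D != fset0 ->
  min_content D <= c <= max_content D -> exists2 b, b \in D & box_content b = c.
Proof.
move=> conn D0 /andP[c1 c2].
have [bl blD blc] := min_contentP D0; have [bh bhD bhc] := max_contentP D0.
case: (ltrgtP c (max_content D)) => [ch|ch|->]; last by exists bh.
- have xc : box_content bl <= c by rewrite blc.
  have cy : c < box_content bh by rewrite bhc.
  have [b [b' [bD _ _ bc _]]] := connected_crossing conn blD bhD xc cy.
  by exists b.
- by move: (le_lt_trans c2 ch); rewrite ltxx.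
Qed.

(** A ribbon seen as a graph over the content axis, with [rho] giving the row; [rho] is total and so
    also prolongs the ribbon beyond its ends. *)
Definition on_path (D : {fset box}) (rho : int -> int) (lo hi : int) : Prop :=
  forall b, b \in D = (lo <= box_content b <= hi) && (b.1 == rho (box_content b)).

Definition path_steps (rho : int -> int) : Prop :=
  forall c, rho (c + 1) = rho c \/ rho (c + 1) = rho c - 1.

Lemma path_steps_mono (rho : int -> int) (c c' : int) : path_steps rho -> c <= c' ->
  rho c' <= rho c <= rho c' + (c' - c).
Proof.
move=> st cc'; have -> : c' = c + (absz (c' - c))%:Z by lia.
elim: (absz _) => [|d IH]; first by rewrite addr0; lia.
have -> : c + d.+1%:Z = c + d%:Z + 1 by lia.
by case: (st (c + d%:Z)) => ->; lia.
Qed.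

Lemma path_convex D rho lo hi : path_steps rho -> on_path D rho lo hi -> convex D.
Proof.
move=> st DP [x1 x2] [y1 y2] [z1 z2]; rewrite !DP /box_content /=.
move=> /andP[xc /eqP x1E] /andP[yc /eqP y1E] z1b z2b.
have h a b : a <= b -> _ := @path_steps_mono rho a b st.
case: (lerP (x2 - x1) (y2 - y1)) => xy.
  have := h _ _ xy; have := h (x2 - x1) (z2 - z1); have := h (z2 - z1) (y2 - y1).
  by lia.
have := h _ _ (ltW xy); have := h (y2 - y1) (z2 - z1); have := h (z2 - z1) (x2 - x1).
by lia.
Qed.

(** Two boxes on one diagonal would span a square by convexity. *)
Lemma ribbon_content_inj (D : {fset box}) (b b' : box) : ribbon D ->
  b \in D -> b' \in D -> box_content b = box_content b' -> b = b'.
Proof.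
case=> _ /is_skew_convex Dc _ nsq.
wlog lt : b b' / b.1 < b'.1.
  move=> W bD b'D E; case: (ltrgtP b.1 b'.1) => [lt|lt|eq1].
  - exact: W.
  - by apply/esym/W.
  - exact: box_eq.
case: b b' lt => b1 b2 [b1' b2'] /= lt bD b'D; rewrite /box_content /= => E.
case: nsq; exists b1, b2.
by split; apply: (Dc _ _ _ bD b'D) => /=; lia.
Qed.

Lemma ribbon_path (D : {fset box}) : ribbon D -> exists rho,
  path_steps rho /\ on_path D rho (min_content D) (max_content D).
Proof.
move=> rD; have [D0 _ conn _] := rD.
pose lo := min_content D; pose hi := max_content D.
have [bl blD blc] := min_contentP D0; have [bh bhD bhc] := max_contentP D0.
have lohi : lo <= hi by have := content_bounds blD; rewrite -/lo -/hi; lia.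
have exb c : lo <= c <= hi -> exists2 b, b \in D & box_content b = c.
  exact: contents_interval.
have clampE c : lo <= c <= hi -> Num.max lo (Num.min c hi) = c by clear; lia.
have clamp_out c : ~~ ((lo <= c) && (c < hi)) ->
  Num.max lo (Num.min (c + 1) hi) = Num.max lo (Num.min c hi) by clear -lohi; lia.
pose row c := if [pick b : D | box_content (val b) == c] is Some b then (val b).1 else 0.
have rowE b : b \in D -> row (box_content b) = b.1.
  move=> bD; rewrite /row; case: pickP => [b' /eqP E|/(_ [` bD])]; last by rewrite eqxx.
  by rewrite (ribbon_content_inj rD (valP b') bD E).
(* Clamping the content prolongs the ribbon horizontally on both sides, so the step condition holds
   at every content. *)
pose clamp c := Num.max lo (Num.min c hi).
exists (fun c => row (clamp c)); split=> [c|b]; last first.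
  apply/idP/andP => [bD|[bc /eqP b1]].
    split; first exact: content_bounds.
    by rewrite /clamp clampE ?rowE // content_bounds.
  have [b' b'D E] := exb _ bc.
  rewrite (_ : b = b') //; apply: box_eq => //; rewrite b1 -rowE // E.
  by rewrite /clamp clampE.
case: (boolP ((lo <= c) && (c < hi))) => [/andP[loc chi]|out]; last first.
  by left; rewrite /clamp clamp_out.
rewrite /clamp !clampE; [|by rewrite loc ltW|by clear -loc chi; lia].
have xc : box_content bl <= c by rewrite blc.
have cy : c < box_content bh by rewrite bhc.
have [b [b' [bD b'D adj bc b'c]]] := connected_crossing conn blD bhD xc cy.
rewrite -b'c (rowE _ b'D) -bc (rowE _ bD); apply: adjacent_succ => //.
by rewrite bc.
Qed.

(** * Existence of the cutting strip *)

Lemma down_closed_threshold (P : pred nat) (N : nat) :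
  (forall i j, (i <= j)%N -> P j -> P i) -> ~~ P N ->
  exists h, forall j, (j < h)%N = P j.
Proof.
move=> dc PN; have ex : exists j, ~~ P j by exists N.
case: (ex_minnP ex) => h Ph hmin; exists h => j; apply/idP/idP => [jh|Pj].
  by apply: contraLR jh => /hmin; rewrite -leqNgt.
by rewrite ltnNge; apply: contra Ph => hj; apply: dc Pj.
Qed.

Lemma partition_of_fun (f : nat -> nat) (N : nat) :
  (forall i j, (i <= j)%N -> (f j <= f i)%N) -> f N = 0%N ->
  exists s, is_partition s /\ forall i, nth 0%N s i = f i.
Proof.
move=> fdec fN; have [||h hP] := @down_closed_threshold (fun i => 0 < f i)%N N.
- by move=> i j ij; move/leq_trans; apply; apply: fdec.
- by rewrite fN.
have nthE i : nth 0%N (mkseq f h) i = f i.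
  case: (ltnP i h) => ih; first by rewrite nth_mkseq.
  by rewrite nth_default ?size_mkseq //; have := hP i; lia.
exists (mkseq f h); split=> //; apply/andP; split.
  by apply/(sortedP 0%N) => i _; rewrite !nthE; apply: fdec.
apply/(nthP 0%N) => -[i]; rewrite size_mkseq => ih; rewrite nthE => fi.
by have := hP i; rewrite ih fi.
Qed.

(** [lam] is the order ideal generated by [D] in the positive quadrant and [mu] its part not above
    any box of [D]; convexity makes their difference exactly [D]. The cutting strip, built as a
    path, becomes a skew diagram this way. *)
Lemma convex_is_skew (D : {fset box}) : convex D ->
  (forall b, b \in D -> 1 <= b.1 /\ 1 <= b.2) -> is_skew_diagram D.
Proof.
move=> Dc Dpos.
pose low i j := [exists y : D, (i.+1%:Z <= (val y).1) && (j.+1%:Z <= (val y).2)].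
pose high i j := [exists x : D, ((val x).1 <= i.+1%:Z) && ((val x).2 <= j.+1%:Z)].
pose N := (\sum_(b : D) (absz (val b).1 + absz (val b).2))%N.
have bN (b : box) : b \in D -> (absz b.1 + absz b.2 <= N)%N.
  by move=> bD; rewrite /N (bigD1 [` bD]) //= leq_addr.
have low_le i j i' j' : (i <= i')%N -> (j <= j')%N -> low i' j' -> low i j.
  move=> ii jj /existsP[y /andP[y1 y2]]; apply/existsP; exists y.
  by move: y1 y2; rewrite /=; lia.
have high_le i j i' j' : (i <= i')%N -> (j <= j')%N -> high i j -> high i' j'.
  move=> ii jj /existsP[y /andP[y1 y2]]; apply/existsP; exists y.
  by move: y1 y2; rewrite /=; lia.
have lowN1 j : ~~ low N j.
  apply/existsP => -[y /andP[]]; have := bN _ (valP y); rewrite /=; lia.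
have lowN2 i : ~~ low i N.
  apply/existsP => -[y /andP[_]]; have := bN _ (valP y); rewrite /=; lia.
have /choice[f fP] : forall i, exists h, forall j, (j < h)%N = low i j.
  move=> i; apply: (@down_closed_threshold _ N) => // j j' jj; exact: low_le.
have /choice[g gP] : forall i, exists h, forall j, (j < h)%N = low i j && ~~ high i j.
  move=> i; apply: (@down_closed_threshold _ N) => [j j' jj|].
    case/andP=> /low_le -> //=; apply: contra; exact: high_le.
  by rewrite (negPf (lowN2 i)).
have leP m n : (forall j, (j < m)%N -> (j < n)%N) -> (m <= n)%N.
  by move=> h; rewrite leqNgt; apply/negP => /h; rewrite ltnn.
have [lam [lamP lamE]] : exists s, is_partition s /\ forall i, nth 0%N s i = f i.
  apply: (@partition_of_fun _ N) => [i j ij|].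
    by apply: leP => k; rewrite !fP; apply: low_le.
  by apply/eqP; rewrite -leqn0; apply: leP => k; rewrite fP (negPf (lowN1 k)).
have [mu [muP muE]] : exists s, is_partition s /\ forall i, nth 0%N s i = g i.
  apply: (@partition_of_fun _ N) => [i j ij|].
    apply: leP => k; rewrite !gP => /andP[/low_le -> //=].
    by apply: contra; apply: high_le.
  by apply/eqP; rewrite -leqn0; apply: leP => k; rewrite gP (negPf (lowN1 k)).
exists lam, mu; split=> // [i|].
  by rewrite lamE muE; apply: leP => k; rewrite fP gP => /andP[].
apply/fsetP => b; apply/idP/in_skewP => [bD|[i [j [-> ]]]].
  have [b1 b2] := Dpos b bD.
  have E : b = ((absz (b.1 - 1)).+1%:Z, (absz (b.2 - 1)).+1%:Z).
    by case: b b1 b2 {bD} => x y /= ??; congr (_, _); lia.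
  exists (absz (b.1 - 1)), (absz (b.2 - 1)); split=> //.
  have lo : low (absz (b.1 - 1)) (absz (b.2 - 1)).
    by apply/existsP; exists [` bD]; rewrite /= {2 4}E /=; lia.
  have hi : high (absz (b.1 - 1)) (absz (b.2 - 1)).
    by apply/existsP; exists [` bD]; rewrite /= {1 3}E /=; lia.
  by rewrite lamE muE fP lo leqNgt gP lo hi.
rewrite lamE muE fP leqNgt gP; case: (boolP (low i j)) => //= lo; rewrite ?andbF // andbT negbK.
case/existsP=> x /andP[x1 x2]; case/existsP: lo => y /andP[y1 y2].
by apply: (Dc (val x) (val y)); rewrite ?(valP x) ?(valP y) //=; apply/andP.
Qed.

(** * All strips cross a given diagonal in the same direction *)

Section Direction.
Variables (D : {fset box}) (n : nat) (Theta : 'I_n -> {fset box}).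
Hypothesis Dconvex : convex D.
Hypothesis ThetaD : outside_decomposition D Theta.

Definition same_strip (b b' : box) : Prop := exists i, b \in Theta i /\ b' \in Theta i.

Lemma strip_ribbon i : ribbon (Theta i).
Proof. by case: ThetaD. Qed.

Lemma strip_sub i b : b \in Theta i -> b \in D.
Proof.
case: ThetaD => _ _ <- _ _ bi.
by apply/bigfcupP; exists i; rewrite // mem_index_enum.
Qed.

Lemma in_strip b : b \in D -> exists i, b \in Theta i.
Proof. by case: ThetaD => _ _ <- _ _ /bigfcupP[i _ bi]; exists i. Qed.

Lemma strip_disjoint i j b : b \in Theta i -> b \in Theta j -> i = j.
Proof.
move=> bi bj; apply/eqP/negPn/negP => ij; case: ThetaD => _ /(_ i j ij) + _ _ _.
by move/fdisjointP => /(_ b bi); rewrite bj.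
Qed.

Lemma same_strip_sym b b' : same_strip b b' -> same_strip b' b.
Proof. by case=> i [??]; exists i. Qed.

Lemma same_strip_inj b b' b'' : same_strip b b' -> same_strip b b'' ->
  box_content b' = box_content b'' -> b' = b''.
Proof.
move=> [i [bi b'i]] [j [bj b''j]]; have E := strip_disjoint bi bj; subst j.
exact: ribbon_content_inj (strip_ribbon i) _ _.
Qed.

Definition right_box (b : box) : box := (b.1, b.2 + 1).
Definition up_box (b : box) : box := (b.1 - 1, b.2).

Lemma content_right b : box_content (right_box b) = box_content b + 1.
Proof. by rewrite /box_content /=; lia. Qed.

Lemma content_up b : box_content (up_box b) = box_content b + 1.
Proof. by rewrite /box_content /=; lia. Qed.

Lemma strip_next i b : b \in Theta i -> box_content b < max_content (Theta i) ->
  right_box b \in Theta i \/ up_box b \in Theta i.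
Proof.
move=> bi bc; have [rho [st rP]] := ribbon_path (strip_ribbon i).
move: bi; rewrite !rP content_right content_up /= => /andP[bm /eqP b1].
case: (st (box_content b)) => ->; rewrite -b1 eqxx andbT; [left|right]; lia.
Qed.

Lemma strip_prev i b : b \in Theta i -> min_content (Theta i) < box_content b ->
  left_box b \in Theta i \/ below_box b \in Theta i.
Proof.
move=> bi bc; have [rho [st rP]] := ribbon_path (strip_ribbon i).
move: bi; rewrite !rP => /andP[bm /eqP b1].
have cl : box_content (left_box b) = box_content b - 1 by rewrite /box_content /=; lia.
have cb : box_content (below_box b) = box_content b - 1 by rewrite /box_content /=; lia.
rewrite cl cb /= b1; have := st (box_content b - 1); rewrite subrK => -[->|->]; [left|right].
  by rewrite eqxx andbT; lia.
by rewrite subrK eqxx andbT; lia.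
Qed.

(** A box with both successors in [D] violates the end condition, so its strip must continue. *)
Lemma same_strip_out b : b \in D -> right_box b \in D -> up_box b \in D ->
  same_strip b (right_box b) \/ same_strip b (up_box b).
Proof.
move=> bD rD uD; have [i bi] := in_strip bD.
have : box_content b <= max_content (Theta i) by case/andP: (content_bounds bi).
rewrite le_eqVlt => /orP[/eqP bc|/(strip_next bi) [h|h]]; last 2 first.
- by left; exists i.
- by right; exists i.
case: ThetaD => _ _ _ _ endP; case: b bi bc bD rD uD => u v bi bc _ rD uD.
by case: (endP i u v bi bc); rewrite ?rD ?uD.
Qed.

Lemma same_strip_in b : b \in D -> left_box b \in D -> below_box b \in D ->
  same_strip (left_box b) b \/ same_strip (below_box b) b.
Proof.
move=> bD rD uD; have [i bi] := in_strip bD.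
have : min_content (Theta i) <= box_content b by case/andP: (content_bounds bi).
rewrite le_eqVlt => /orP[/eqP bc|/(strip_prev bi) [h|h]]; last 2 first.
- by left; exists i.
- by right; exists i.
case: ThetaD => _ _ _ startP _; case: b bi bc bD rD uD => u v bi bc _ rD uD.
by case: (startP i u v bi (esym bc)); rewrite ?rD ?uD.
Qed.

Definition goes_right (c r : int) : Prop := same_strip (r, r + c) (r, r + c + 1).
Definition goes_up (c r : int) : Prop := same_strip (r, r + c) (r - 1, r + c).

Lemma same_strip_D b b' : same_strip b b' -> b \in D /\ b' \in D.
Proof. by case=> i [bi b'i]; split; apply: strip_sub; eassumption. Qed.

Lemma goes_out c r : (r, r + c) \in D -> (r, r + c + 1) \in D ->
  (r - 1, r + c) \in D -> goes_right c r \/ goes_up c r.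
Proof. exact: same_strip_out. Qed.

Lemma goes_in c r : (r, r + c) \in D -> (r + 1, r + 1 + c) \in D ->
  (r, r + c + 1) \in D -> goes_right c r \/ goes_up c (r + 1).
Proof.
move=> b1 b2 b3; have := same_strip_in b3.
rewrite /left_box /below_box /= addrK /goes_right /goes_up addrK.
rewrite (_ : r + 1 + c = r + c + 1) in b2 *; last by lia.
by move=> /(_ b1 b2) [h|h]; [left|right].
Qed.

Lemma goes_right_up_next c r : goes_right c r -> goes_up c (r + 1) -> False.
Proof.
rewrite /goes_right /goes_up addrK (_ : r + 1 + c = r + c + 1); last by lia.
move=> /same_strip_sym h1 /same_strip_sym h2.
have [] : (r, r + c) = (r + 1, r + c + 1).
  by apply: (same_strip_inj h1 h2); rewrite /box_content /=; lia.
by lia.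
Qed.

Lemma goes_right_up c r : goes_right c r -> goes_up c r -> False.
Proof.
move=> h1 h2; have [] : (r, r + c + 1) = (r - 1, r + c).
  by apply: (same_strip_inj h1 h2); rewrite /box_content /=; lia.
by lia.
Qed.

(* A mixed pair propagates along the diagonal to a mixed pair one step closer,
   because the boxes in between are neither admissible starts nor ends. *)
Lemma no_mixed_steps c r r' : goes_right c r -> goes_up c r' -> False.
Proof.
case: (lerP r' r) => rr.
  have -> : r = r' + (absz (r - r'))%:Z by lia.
  move: (absz _) => d; elim: d r' {rr} => [|d IH] s; first by rewrite addr0; apply: goes_right_up.
  move=> hr hu; have [d1 d2] := same_strip_D hr; have [d3 d4] := same_strip_D hu.
  have d5 : (s, s + c + 1) \in D by apply: (Dconvex d3 d2) => /=; lia.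
  have d6 : (s + 1, s + 1 + c) \in D by apply: (Dconvex d3 d1) => /=; lia.
  case: (goes_in d3 d6 d5) => [hr'|]; first exact: goes_right_up hr' hu.
  by apply: IH; rewrite (_ : s + 1 + d%:Z = s + d.+1%:Z) //; lia.
have -> : r' = r + 1 + (absz (r' - r - 1)%R)%:Z by lia.
move: (absz _) => d; elim: d r {rr} => [|d IH] s; first by rewrite addr0; apply: goes_right_up_next.
move=> hr hu; have [d1 d2] := same_strip_D hr; have [d3 d4] := same_strip_D hu.
have d5 : (s + 1, s + 1 + c) \in D by apply: (Dconvex d1 d3) => /=; lia.
have d6 : (s + 1, s + 1 + c + 1) \in D by apply: (Dconvex d2 d4) => /=; lia.
have d7 : (s + 1 - 1, s + 1 + c) \in D.
  by rewrite addrK (_ : s + 1 + c = s + c + 1) //; lia.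
case: (goes_out d5 d6 d7) => [hr'|hu']; last exact: goes_right_up_next hr hu'.
by apply: (IH (s + 1)) => //; rewrite (_ : s + 1 + 1 + d%:Z = s + 1 + d.+1%:Z) //; lia.
Qed.

(** Convexity supplies the neighbour that makes a start or an end inadmissible, so some strip
    crosses here; [no_mixed_steps] leaves only the step to the right. *)
Lemma goes_right_all c r r' : goes_right c r -> (r', r' + c) \in D ->
  (r', r' + c + 1) \in D -> goes_right c r'.
Proof.
move=> hr d3 d4; have [d1 d2] := same_strip_D hr.
case: (ltrgtP r r') => [rr|rr|<- //].
  have d5 : (r' - 1, r' + c) \in D by apply: (Dconvex d2 d3) => /=; lia.
  by case: (goes_out d3 d4 d5) => // /(no_mixed_steps hr).
have d5 : (r' + 1, r' + 1 + c) \in D by apply: (Dconvex d3 d1) => /=; lia.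
by case: (goes_in d3 d5 d4) => // /(no_mixed_steps hr).
Qed.

Lemma goes_up_all c r r' : goes_up c r -> (r', r' + c) \in D ->
  (r' - 1, r' + c) \in D -> goes_up c r'.
Proof.
move=> hu d3 d4; have [d1 d2] := same_strip_D hu.
case: (ltrgtP r r') => [rr|rr|<- //].
  have d5 : (r' - 1, r' - 1 + c) \in D by apply: (Dconvex d1 d3) => /=; lia.
  have := @goes_in c (r' - 1); rewrite subrK.
  rewrite (_ : r' - 1 + c + 1 = r' + c); last by lia.
  by move=> /(_ d5 d3 d4) [/no_mixed_steps /(_ hu)|].
have d5 : (r', r' + c + 1) \in D by apply: (Dconvex d3 d2) => /=; lia.
by case: (goes_out d3 d5 d4) => // /no_mixed_steps /(_ hu).
Qed.

(** When horizontal and vertical neighbours both occur between contents [c] and [c + 1], convexity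
    yields a box whose strip has to cross. Hence, if no strip crosses, one direction is free of
    adjacent pairs. *)
Lemma right_or_up_exclusive c r r' : (r, r + c) \in D -> (r, r + c + 1) \in D ->
  (r', r' + c) \in D -> (r' - 1, r' + c) \in D ->
  (exists s, goes_right c s) \/ (exists s, goes_up c s).
Proof.
move=> d1 d2 d3 d4; case: (lerP r' r) => rr.
  have d5 : (r', r' + c + 1) \in D by apply: (Dconvex d3 d2) => /=; lia.
  by case: (goes_out d3 d5 d4) => ?; [left|right]; exists r'.
have d5 : (r + 1, r + 1 + c) \in D by apply: (Dconvex d1 d3) => /=; lia.
by case: (goes_in d1 d5 d2) => ?; [left; exists r|right; exists (r + 1)].
Qed.

Definition step_box (d : bool) (b : box) : box :=
  if d then right_box b else up_box b.

Lemma box_diag (b : box) : b = (b.1, b.1 + box_content b).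
Proof. by case: b => x y; rewrite /box_content /=; congr (_, _); lia. Qed.

(** The first clause lets the strips be translated into the cutting strip; the second is the source
    of the last condition on it. *)
Lemma strip_direction (c : int) : exists d : bool,
  (forall i b, b \in Theta i -> box_content b = c -> c < max_content (Theta i) ->
     step_box d b \in Theta i) /\
  (forall b, b \in D -> box_content b = c -> step_box d b \in D ->
     same_strip b (step_box d b)).
Proof.
have gr b : box_content b = c -> same_strip b (right_box b) = goes_right c b.1.
  by move=> bc; rewrite /goes_right -bc -box_diag /right_box [b.2 in LHS](congr1 snd (box_diag b)).
have gu b : box_content b = c -> same_strip b (up_box b) = goes_up c b.1.
  by move=> bc; rewrite /goes_up -bc -box_diag /up_box [b.2 in LHS](congr1 snd (box_diag b)).
have dE b : box_content b = c -> b = (b.1, b.1 + c) by move=> <-; exact: box_diag.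
have rE b : box_content b = c -> right_box b = (b.1, b.1 + c + 1).
  by move=> bc; rewrite {1}(dE _ bc).
have uE b : box_content b = c -> up_box b = (b.1 - 1, b.1 + c).
  by move=> bc; rewrite {1}(dE _ bc).
have [[r0 hr]|nr] := pselect (exists r, goes_right c r).
  exists true; split=> [i b bi bc bm|b bD bc sD] /=; last first.
    rewrite gr //; apply: goes_right_all hr _ _; first by rewrite -dE.
    by rewrite -rE.
  rewrite -bc in bm; case: (strip_next bi bm) => // ub; case: (@no_mixed_steps c r0 b.1) => //.
  by rewrite -gu //; exists i.
have [[r0 hu]|nu] := pselect (exists r, goes_up c r).
  exists false; split=> [i b bi bc bm|b bD bc sD] /=; last first.
    rewrite gu //; apply: goes_up_all hu _ _; first by rewrite -dE.
    by rewrite -uE.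
  rewrite -bc in bm; case: (strip_next bi bm) => // rb; case: nr; exists b.1.
  by rewrite -gr //; exists i.
have pass i b : b \in Theta i -> box_content b = c -> c < max_content (Theta i) -> False.
  move=> bi bc bm; rewrite -bc in bm; case: (strip_next bi bm) => h.
    by apply: nr; exists b.1; rewrite -gr //; exists i.
  by apply: nu; exists b.1; rewrite -gu //; exists i.
(* No strip crosses from [c] to [c + 1]: take a direction in which no two boxes
   of [D] are adjacent. *)
have [[r [d1 d2]]|nadj] := pselect (exists r, (r, r + c) \in D /\ (r, r + c + 1) \in D).
  exists false; split=> [i b bi bc bm|b bD bc sD]; first by case: (pass i b).
  rewrite (dE _ bc) in bD; rewrite /step_box uE // in sD.
  by case: (right_or_up_exclusive d1 d2 bD sD).
exists true; split=> [i b bi bc bm|b bD bc sD]; first by case: (pass i b).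
case: nadj; exists b.1; split; first by rewrite -dE.
by rewrite -rE.
Qed.

End Direction.

(** * Assembling the cutting strip from its directions *)

Lemma path_edge_connected S rho lo hi : path_steps rho -> on_path S rho lo hi ->
  edge_connected S.
Proof.
move=> st SP.
have inS c : lo <= c <= hi -> (rho c, rho c + c) \in S.
  by move=> cb; rewrite SP /box_content /= addrC addKr cb eqxx.
have sym : connect_sym (fun a b : S => edge_adjacent (val a) (val b)).
  by apply: sym_connect_sym => a b; apply: edge_adjacent_sym.
have conn (d : nat) (x y : S) : box_content (val y) = box_content (val x) + d%:Z ->
    connect (fun a b : S => edge_adjacent (val a) (val b)) x y.
  elim: d y => [|d IH] y yx.
    rewrite (_ : y = x) ?connect0 //; apply: val_inj.
    rewrite addr0 in yx; apply: box_eq => //.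
    have := valP x; have := valP y; rewrite !SP yx => /andP[_ /eqP ->].
    by case/andP => _ /eqP ->.
  pose c := box_content (val x) + d%:Z.
  have yc : box_content (val y) = c + 1 by rewrite yx /c -addn1 PoszD addrA.
  have := valP y; have := valP x; rewrite !SP yc => /andP[xb _] /andP[yb /eqP y1].
  have zS : (rho c, rho c + c) \in S.
    by apply: inS; move: xb yb; rewrite /c; move: (box_content _); clear; lia.
  apply: connect_trans (IH [` zS] _) _.
    by rewrite /box_content /= -/(box_content _) addrC addKr.
  apply: connect1; rewrite (box_diag (val y)) yc /edge_adjacent /= y1.
  by case: (st c) => ->; clear; lia.
move=> x y; case: (leP (box_content (val x)) (box_content (val y))) => [|/ltW] xy.
  apply: (conn (absz (box_content (val y) - box_content (val x)))).
  by rewrite gez0_abs ?subr_ge0 // addrCA subrr addr0.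
rewrite sym; apply: (conn (absz (box_content (val x) - box_content (val y)))).
by rewrite gez0_abs ?subr_ge0 // addrCA subrr addr0.
Qed.

Lemma path_ribbon S rho lo hi : path_steps rho -> on_path S rho lo hi -> lo <= hi ->
  (forall b, b \in S -> 1 <= b.1 /\ 1 <= b.2) -> ribbon S.
Proof.
move=> st SP lohi Spos; split.
- apply/fset0Pn; exists (rho lo, rho lo + lo).
  by rewrite SP /box_content /= (addrC (rho lo)) addrK lexx lohi eqxx.
- by apply: convex_is_skew => //; apply: path_convex st SP.
- exact: path_edge_connected st SP.
- case=> i [j []]; rewrite !SP /box_content /= => /andP[_ /eqP i1] _ _ /andP[_ /eqP i2].
  by rewrite (_ : j + 1 - (i + 1) = j - i) in i2; lia.
Qed.

Lemma contents_min (D S : {fset box}) : contents S = contents D ->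
  min_content S = min_content D.
Proof. by rewrite /min_content => ->. Qed.

Lemma contents_max (D S : {fset box}) : contents S = contents D ->
  max_content S = max_content D.
Proof. by rewrite /max_content => ->. Qed.

Lemma cutting_strip_exists (D : {fset box}) (n : nat) (Theta : 'I_n -> {fset box}) :
  convex D -> edge_connected D -> D != fset0 -> outside_decomposition D Theta ->
  exists S, is_cutting_strip D Theta S.
Proof.
move=> Dc conn D0 ThD.
have /choice[d dP] := strip_direction Dc ThD.
pose lo := min_content D; pose hi := max_content D.
have lohi : lo <= hi.
  by have [b bD _] := min_contentP D0; have := content_bounds bD; rewrite -/lo -/hi; lia.
(* [K] is large enough to make all coordinates positive. *)
pose K := hi - lo + `|lo| + 1.
(* The row drops by one for each upward step between [lo] and [c]; the truncation at 0 keeps it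
   constant below [lo]. *)
pose rho c := K - \sum_(j < absz (Num.max 0 (c - lo))) (~~ d (lo + j%:Z))%:Z.
have rhoS c : lo <= c -> rho (c + 1) = rho c - (~~ d c)%:Z.
  move=> loc; rewrite /rho.
  have -> : absz (Num.max 0 (c + 1 - lo)) = (absz (Num.max 0 (c - lo))).+1 by clear -loc; lia.
  rewrite big_ord_recr /= opprD addrA; congr (_ - (~~ d _)%:Z); clear -loc; lia.
have st : path_steps rho.
  move=> c; case: (lerP lo c) => loc.
    by rewrite rhoS //; case: (d c); [left; rewrite subr0|right].
  by left; rewrite /rho (_ : absz (Num.max 0 (c + 1 - lo)) = absz (Num.max 0 (c - lo))) //;
    clear -loc; lia.
have rholo : rho lo = K.
  by rewrite /rho subrr (_ : absz (Num.max 0 0) = 0%N) ?big_ord0 ?subr0.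
pose S : {fset box} := [fset (rho c, rho c + c) | c in contents D].
have SP : on_path S rho lo hi.
  move=> b; apply/imfsetP/andP => [[c /= /imfsetP[b' /= b'D ->] ->]|[bc /eqP b1]].
    by rewrite /box_content /= (addrC (rho _)) addrK eqxx; split=> //; apply: content_bounds.
  exists (box_content b) => /=; last by rewrite -b1; apply: box_diag.
  by have [b' b'D <-] := contents_interval conn D0 bc; apply: mem_contents.
have Spos b : b \in S -> 1 <= b.1 /\ 1 <= b.2.
  rewrite SP => /andP[/andP[bl bh] /eqP b1].
  have := path_steps_mono st bl; rewrite rholo -b1 /K.
  by rewrite (_ : b.2 = b.1 + box_content b); [lia | rewrite {1}(box_diag b)].
have Srib := path_ribbon st SP lohi Spos.
have SD : contents S = contents D.
  apply/fsetP => c; apply/imfsetP/idP => [[b /= bS ->]|cD].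
    move: bS; rewrite SP => /andP[bc _].
    by have [b' b'D <-] := contents_interval conn D0 bc; apply: mem_contents.
  exists (rho c, rho c + c); first by apply/imfsetP; exists c.
  by rewrite /box_content /= addrC addKr.
have succ b b' t : b \in D -> b' \in D -> box_content b' = box_content b + 1 ->
    diag_shift t b \in S -> diag_shift t b' \in S -> same_strip Theta b b'.
  move=> bD b'D bb' bS b'S; have [_ dD] := dP (box_content b).
  have bl : lo <= box_content b by case/andP: (content_bounds bD).
  have ds x : box_content (diag_shift t x) = box_content x.
    by rewrite /box_content /=; lia.
  move: bS b'S; rewrite !SP !ds bb' rhoS // => /andP[_ /eqP /= b1] /andP[_ /eqP /= b1'].
  have E : b' = step_box (d (box_content b)) b.
    apply: box_eq; first by rewrite bb' /step_box; case: ifP; rewrite ?content_right ?content_up.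
    by move: b1'; rewrite -b1 /step_box; case: (d _) => /=; lia.
  by rewrite E; apply: dD => //; rewrite -E.
exists S; split=> //.
- move=> i; have [rhoi [sti iP]] := ribbon_path (strip_ribbon ThD i).
  set p := min_content (Theta i) in iP; set q := max_content (Theta i) in iP.
  exists (rho p - rhoi p) => b bi.
  have bD := strip_sub ThD bi.
  have Ti0 : Theta i != fset0 by apply/fset0Pn; exists b.
  have lop : lo <= p.
    have [x xi xp] := min_contentP Ti0.
    by rewrite /p -xp; case/andP: (content_bounds (strip_sub ThD xi)).
  (* The shift aligns the first boxes, and from there the strip and [S] take the same steps. *)
  have follow (k : nat) : p + k%:Z <= q -> rhoi (p + k%:Z) + (rho p - rhoi p) = rho (p + k%:Z).
    elim: k => [|k IH]; first by rewrite addr0 addrC subrK.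
    set c := p + k%:Z => cq; have -> : p + k.+1%:Z = c + 1 by rewrite /c; lia.
    have {}IH : rhoi c + (rho p - rhoi p) = rho c by apply: IH; rewrite -/c; lia.
    have xi : (rhoi c, rhoi c + c) \in Theta i.
      by rewrite iP /box_content /= (addrC (rhoi c)) addrK eqxx andbT /c; lia.
    have xc : box_content (rhoi c, rhoi c + c) = c by rewrite /box_content /=; lia.
    have [dT _] := dP c; have ltq : c < q by lia.
    have := dT i _ xi xc ltq; rewrite iP => /andP[_]; rewrite rhoS; last by rewrite /c; lia.
    rewrite /step_box; case: (d c); rewrite ?content_right ?content_up xc /= => /eqP E; lia.
  move: bi; rewrite iP => /andP[bpq /eqP b1].
  rewrite SP (_ : box_content (diag_shift _ b) = box_content b); last by rewrite /box_content /=; lia.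
  rewrite content_bounds //= b1; apply/eqP.
  have := follow (absz (box_content b - p)).
  rewrite (_ : p + (absz (box_content b - p)%R)%:Z = box_content b); last by lia.
  by apply; lia.
- move=> b b' bD b'D /edge_adjacent_content bb' [t [bS b'S]].
  case: bb' => bb'; first exact: (succ b b' t).
  by apply: same_strip_sym; apply: (succ b' b t).
Qed.

(** * The determinant formula *)

Section StripSystemOfDecomposition.
Variables (D : {fset box}) (n : nat) (Theta : 'I_n -> {fset box}).
Hypothesis Dconvex : convex D.
Hypothesis Dconn : edge_connected D.
Hypothesis ThetaD : outside_decomposition D Theta.

Let p i := min_content (Theta i).
Let q i := max_content (Theta i).

Lemma strip_content i c : p i <= c <= q i ->
  exists2 b, b \in Theta i & box_content b = c.
Proof.
by have [T0 _ Tc _] := strip_ribbon ThetaD i; apply: contents_interval.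
Qed.

Lemma strip_min_le_max i : p i <= q i.
Proof.
have [/min_contentP[b bi bp] _ _ _] := strip_ribbon ThetaD i.
by have := content_bounds bi; rewrite bp => /andP[].
Qed.

(** The data needed for the sweep: [rho] parametrizes the cutting strip and [t i] translates strip
    [i] into it. *)
Lemma decomposition_path : exists (rho : int -> int) (t : 'I_n -> int),
  [/\ path_steps rho,
      forall b : box, b \in D <->
        exists i, alive p q i (box_content b) /\ b.1 = rho (box_content b) - t i,
      forall i j c, alive p q i c || alive p q i (c + 1) ->
        alive p q j c || alive p q j (c + 1) -> t i = t j -> i = j
    & forall i j, on_path
        [fset b in cutting_strip D Theta | p i <= box_content b <= q j]
        rho (p i) (q j)].
Proof.
(* An empty [D] admits no cutting strip, but it has no strips either. *)
case: (eqVneq D fset0) => [D0|D0].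
  have n0 (i : 'I_n) : False.
    have [/fset0Pn[b bi] _ _ _] := strip_ribbon ThetaD i.
    by have := strip_sub ThetaD bi; rewrite D0 in_fset0.
  exists (fun=> 0), (fun=> 0); split=> [c|b|i|i]; [by left| |by case: (n0 i)|by case: (n0 i)].
  by split=> [|[i]]; [rewrite D0 in_fset0|case: (n0 i)].
have : is_cutting_strip D Theta (cutting_strip D Theta).
  rewrite /cutting_strip; case: xgetP => [S -> //|noS].
  by have [S /noS] := cutting_strip_exists Dconvex Dconn D0 ThetaD.
set S := cutting_strip D Theta => -[Srib SD /choice[t tS] Sadj].
have [rho [st SP]] := ribbon_path Srib.
rewrite (contents_min SD) (contents_max SD) in SP.
have shift_content s b : box_content (diag_shift s b) = box_content b.
  by rewrite /box_content /=; lia.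
have row i b : b \in Theta i -> b.1 = rho (box_content b) - t i.
  by move=> /(tS i); rewrite SP shift_content => /andP[_ /eqP <-] /=; lia.
have DP (b : box) : b \in D <->
    exists i, alive p q i (box_content b) /\ b.1 = rho (box_content b) - t i.
  split=> [/(in_strip ThetaD)[i bi]|[i [/strip_content[b' b'i E] b1]]].
    by exists i; split; [apply: content_bounds|apply: row].
  suff -> : b = b' by apply: (strip_sub ThetaD) b'i.
  by apply: box_eq; rewrite // b1 (row i b') // E.
exists rho, t; split=> // [i j c|i j b]; last first.
  rewrite in_fset !inE /= SP; apply/idP/idP => [/andP[/andP[_ ->] ->] //|].
  case/andP=> bc ->; rewrite bc !andbT.
  have [b1 b1i b1p] := strip_content (i := i) (c := p i) (introT andP (conj (lexx _) (strip_min_le_max i))).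
  have [b2 b2j b2q] := strip_content (i := j) (c := q j) (introT andP (conj (strip_min_le_max j) (lexx _))).
  have := content_bounds (strip_sub ThetaD b1i); have := content_bounds (strip_sub ThetaD b2j).
  by rewrite b1p b2q; move: bc; clear; lia.
have same i1 i2 c' : alive p q i1 c' -> alive p q i2 c' -> t i1 = t i2 -> i1 = i2.
  move=> /strip_content[b1 b1i E1] /strip_content[b2 b2i E2] t12.
  have E : b1 = b2 by apply: box_eq; rewrite ?E1 // (row _ _ b1i) (row _ _ b2i) E1 E2 t12.
  by subst b2; apply: strip_disjoint ThetaD _ _ _ b1i b2i.
(* With equal shifts the two boxes are neighbours whose translates are consecutive in [S], so the
   last condition on a cutting strip puts them in one strip. *)
have next i1 i2 : alive p q i1 c -> alive p q i2 (c + 1) -> t i1 = t i2 -> i1 = i2.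
  move=> /strip_content[b1 b1i E1] /strip_content[b2 b2i E2] t12.
  have adj : edge_adjacent b1 b2.
    rewrite (box_diag b1) (box_diag b2) (row _ _ b1i) (row _ _ b2i) E1 E2 t12.
    by rewrite /edge_adjacent /=; case: (st c) => ->; clear; lia.
  have [|i' [b1i' b2i']] := Sadj b1 b2 (strip_sub ThetaD b1i) (strip_sub ThetaD b2i) adj.
    by exists (t i1); split; [exact: tS|rewrite t12; apply: tS].
  by rewrite (strip_disjoint ThetaD b1i b1i') (strip_disjoint ThetaD b2i b2i').
case/orP=> ai /orP[] aj tij.
- exact: same ai aj tij.
- exact: next ai aj tij.
- exact/esym/(next _ _ aj ai)/esym.
- exact: same ai aj tij.
Qed.

End StripSystemOfDecomposition.

Lemma zeta_trunc_path (R : realType) (D : {fset box}) (rho : int -> int) (p q : int)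
    (k : box -> nat) (kc : int -> nat) (M : nat) :
  path_steps rho -> on_path D rho p q -> p <= q ->
  (forall b, b \in D -> k b = kc (box_content b)) ->
  zeta_trunc R D k M.+1 = strip_sum M.+1 (fun c m => m%:R ^- kc c) rho p q.
Proof.
move=> st DP pq kE.
rewrite (@zeta_trunc_det R D 1 rho (fun=> 0) (fun=> p) (fun=> q) k kc) //.
- by rewrite det_mx11 mxE.
- exact: path_convex st DP.
- move=> b; rewrite DP; split=> [/andP[bc /eqP b1]|[i [bc b1]]].
    by exists ord0; rewrite subr0.
  by apply/andP; rewrite b1 subr0.
- by move=> i j; rewrite !ord1.
Qed.

Theorem theorem3p3 (R : realType) (lam mu : seq nat) (n : nat)
    (Theta : 'I_n -> {fset box}) (k : box -> nat)
    (Hlam : is_partition lam) (Hmu : is_partition mu)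
    (Hsub : subpartition mu lam)
    (Hconn : edge_connected (skew_diagram lam mu))
    (HTheta : outside_decomposition (skew_diagram lam mu) Theta)
    (Hk : diagonal_tableau (skew_diagram lam mu) k) :
  zeta_star R (skew_diagram lam mu) k =
  \det (\matrix_(i < n, j < n)
          zeta_star_entry R (skew_diagram lam mu) Theta k i j).
Proof.
have Dc := skew_convex Hlam Hmu.
move: Dc Hconn HTheta Hk; set D := skew_diagram lam mu.
move=> Dc Hconn ThD [kpos kdiag].
have [rho [t [st DP inj secP]]] := decomposition_path Dc Hconn ThD.
have valE b : b \in D -> content_value D k (box_content b) = k b.
  move=> bD; rewrite /content_value; case: pickP => [b' /eqP|/(_ [` bD])].
    exact: kdiag (valP b') bD.
  by rewrite eqxx.
(* [content_value] is 0 off the contents of [D], while the asymptotics are stated for positive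
   exponents at every content; on the contents of [D] the maximum changes nothing. *)
pose kc c := maxn 1 (content_value D k c).
have kc_gt0 c : (0 < kc c)%N by rewrite leq_max.
have kcE b : b \in D -> kc (box_content b) = content_value D k (box_content b).
  by move=> bD; rewrite /kc valE //; apply/maxn_idPr/kpos.
pose x (c : int) (m : nat) : R := m%:R ^- kc c.
pose E i j M := strip_sum M x rho (min_content (Theta i)) (max_content (Theta j)).
pose shift : {poly R} := 'X - (euler_gamma R)%:P.
have entry i j : exists P, log_asymp (E i j) P /\
    zeta_star_entry R D Theta k i j = P \Po shift.
  rewrite /E /zeta_star_entry; case: ifP => pq.
    have [P hP] := strip_sum_log_poly R rho kc_gt0
      (min_content (Theta i)) (max_content (Theta j)).
    exists P; split=> //; apply: zeta_starE; apply: eq_log_small hP => -[//|M] _.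
    congr (_ - _); apply/esym; apply: zeta_trunc_path st (secP i j) pq _ => b bS.
    have D0 : D != fset0.
      have [/fset0Pn[y /(strip_sub ThD) yD] _ _ _] := strip_ribbon ThD i.
      by apply/fset0Pn; exists y.
    have bc : min_content D <= box_content b <= max_content D.
      move: bS; rewrite secP => /andP[bc _].
      have [/min_contentP[y yi yp] _ _ _] := strip_ribbon ThD i.
      have [/max_contentP[z zj zq] _ _ _] := strip_ribbon ThD j.
      have := content_bounds (strip_sub ThD yi); have := content_bounds (strip_sub ThD zj).
      by rewrite yp zq; move: bc; clear; lia.
    by have [y yD <-] := contents_interval Hconn D0 bc; rewrite kcE.
  rewrite /strip_sum pq; case: ifP => _.
    by exists 1%:P; split; [exact: log_asymp_const|rewrite comp_polyC].
  by exists 0%:P; split; [exact: log_asymp_const|rewrite comp_polyC].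
have /choice[P PP] : forall ij, exists P, log_asymp (E ij.1 ij.2) P /\
    zeta_star_entry R D Theta k ij.1 ij.2 = P \Po shift by move=> ij; apply: entry.
have detP := log_asymp_det (fun i j => (PP (i, j)).1).
rewrite (@zeta_starE R D k (\det (\matrix_(i, j) P (i, j)))).
  rewrite -/shift -det_map_mx; congr (\det _); apply/matrixP => i j.
  by rewrite !mxE; apply/esym/(PP (i, j)).2.
apply: eq_log_small detP => -[//|M] _; congr (_ - _).
rewrite (@zeta_trunc_det R D n rho t _ _ k kc M Dc st DP inj) //.
  by move=> i; exact: (strip_min_le_max ThD i).
by move=> b bD; rewrite kcE ?valE.
Qed.
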